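(* Let $d\ge 3$ be a fixed integer and let $G\in\mathcal{G}_{n,d}$ be a random $d$-regular graph. Then with high probability $\mathcal{D}_r(G,\mathcal{T}_n)=\left(\frac{d}{2}-1-o_r(1)\right)n$. Explicitly: for every $\varepsilon>0$ there is $r_0=r_0(d,\varepsilon)$ such that for every fixed integer $r\ge r_0$, with probability tending to $1$ as $n\to\infty$, $$\left(\tfrac{d}{2}-1-\varepsilon\right)n\ \le\ \mathcal{D}_r(G,\mathcal{T}_n)\ \le\ \left(\tfrac{d}{2}-1+\varepsilon\right)n.$$ In other words, with high probability in every $r$-colouring of $E(G)$ there is a spanning tree with at least $\left(\frac{d}{2r}-o\left(\frac1r\right)\right)n$ edges of the same colour, and the constant $\frac{d}{2r}$ is tight.
   Context: $\mathcal{G}_{n,d}$ denotes the uniform distribution over the set of all (simple, labelled) $d$-regular graphs on $n$ vertices, with $dn$ even. ''With high probability'' means with probability tending to $1$ as $n\to\infty$ (over $n$ with $dn$ even). The notation $o_r(1)$ denotes a quantity tending to $0$ as $r\to\infty$. (Such $G$ is connected with high probability, so the quantity below is defined with high probability.) Spanning-tree discrepancy: for a connected $n$-vertex graph $G$, an $r$-colouring $f:E(G)\to[r]$ of its edges, and a spanning tree $T$ of $G$ (which has $n-1$ edges), put $D_f(T) := r\cdot\left(\max_{1\le i\le r}|f^{-1}(i)\cap E(T)| - \frac{n-1}{r}\right)$. The $r$-colour spanning-tree discrepancy of $G$ is $\mathcal{D}_r(G,\mathcal{T}_n) := \min_{f:E(G)\to[r]}\ \max_{T} D_f(T)$, where the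 maximum is over all spanning trees $T$ of $G$. *)

(* Defs.v *)
From HB Require Import structures.
From mathcomp Require Import all_boot all_order all_algebra.
From mathcomp Require Import all_classical all_reals all_analysis.

Set Implicit Arguments.
Unset Strict Implicit.
Unset Printing Implicit Defensive.

Import Order.TTheory GRing.Theory Num.Theory.
Import numFieldNormedType.Exports.

Local Open Scope classical_set_scope.
Local Open Scope ring_scope.

(* A graph on the vertex set 'I_n is identified with its edge set, a set of
   2-element subsets of 'I_n. *)
Definition simple_graph (n : nat) (G : {set {set 'I_n}}) : bool :=
  [forall e in G, #|e| == 2%N].

Definition degree (n : nat) (G : {set {set 'I_n}}) (v : 'I_n) : nat :=
  #|[set e in G | v \in e]|.

Definition regular_graphs (d n : nat) : {set {set {set 'I_n}}} :=
  [set G | simple_graph G & [forall v, degree G v == d]].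

(* On a simple graph this relation is irreflexive, as [set x; x] = [set x]. *)
Definition adjacent (n : nat) (G : {set {set 'I_n}}) : rel 'I_n :=
  fun x y => [set x; y]%SET \in G.

Definition connected_graph (n : nat) (G : {set {set 'I_n}}) : bool :=
  [forall x, forall y, connect (adjacent G) x y].

(* Cycles are duplicate-free cyclic vertex sequences of length at least 3; such
   a sequence has length at most n, whence the finite range of k. *)
Definition acyclic_graph (n : nat) (G : {set {set 'I_n}}) : bool :=
  [forall k : 'I_n.+1, forall s : k.-tuple 'I_n,
     (2 < k)%N ==> ~~ ucycleb (adjacent G) s].

Definition spanning_tree (n : nat) (G T : {set {set 'I_n}}) : bool :=
  [&& T \subset G, connected_graph T & acyclic_graph T].

Definition coloring (n : nat) (G : {set {set 'I_n}}) (r : nat) : finType :=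
  {ffun {e : {set 'I_n} | e \in G} -> 'I_r}.

Definition color_count (n : nat) (G : {set {set 'I_n}}) (r : nat)
    (f : coloring G r) (T : {set {set 'I_n}}) (i : 'I_r) : nat :=
  #|[set e : {e : {set 'I_n} | e \in G} | f e == i & val e \in T]|.

Definition tree_discrepancy (R : realType) (n : nat) (G : {set {set 'I_n}})
    (r : nat) (f : coloring G r) (T : {set {set 'I_n}}) : R :=
  r%:R * ((\max_(i < r) color_count f T i)%N%:R - (n%:R - 1) / r%:R).

(* The minimum and maximum are taken in the extended reals so that they are
   total: if G is disconnected (hence has no spanning tree) and r > 0, the value
   is -oo, which satisfies no finite lower bound. *)
Definition spanning_tree_discrepancy (R : realType) (r n : nat)
    (G : {set {set 'I_n}}) : \bar R :=
  \big[Order.min/+oo%E]_(f : coloring G r)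
    \big[Order.max/-oo%E]_(T : {set {set 'I_n}} | spanning_tree G T)
      (tree_discrepancy R f T)%:E.

(* The junk value 0 / 0 = 0 when there is no d-regular graph on n vertices only
   concerns n <= d or d * n odd. *)
Definition regular_prob (R : realType) (d n : nat)
    (A : pred {set {set 'I_n}}) : R :=
  #|[set G in regular_graphs d n | A G]|%:R / #|regular_graphs d n|%:R.

Definition whp (R : realType) (d : nat)
    (A : forall n : nat, pred {set {set 'I_n}}) : Prop :=
  regular_prob R d (A n)
    @[n --> within [set n | ~~ odd (d * n)%N] \oo] --> (1 : R).

(* Main.v *)
(** The upper bound is witnessed by any balanced colouring. For the lower bound,
    some colour class contains a set F of m = ⌈dn/2r⌉ edges of G, and a maximal
    forest of F extends to a spanning tree of G if G is connected. As r is large, F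
    touches a small proportion of the vertices, and whp every such set of linear size
    k spans at most (1 + 1/p) k edges, while only O(1) sets of at most p vertices span
    a cycle; hence the forest misses only an O(1/p) proportion of F.

    The facts about random regular graphs follow from switchings, which replace two
    edges uv, xy by ux, vy and so act directly on the uniform model. Switching one
    edge of F away shows that G contains a given set F of at most about dn/4 edges
    with probability at most (2d/n)^|F|, and the sparsity statements follow by a
    union bound. For connectivity, switchings across a set S of k vertices show that
    the number of graphs with 2i edges leaving S is at least
    C(a, i) C(b, i) times the number of those with none, where a and b are
    about 5k/4 and 5(n-k)/4; Vandermonde's identity then beats the union bound over S.
    All the exceptional probabilities are O(1/n). *)

Require Import Defs.
From HB Require Import structures.
From mathcomp Require Import all_boot all_order all_algebra.
From mathcomp Require Import zify ring lra.

Set Implicit Arguments.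
Unset Strict Implicit.
Unset Printing Implicit Defensive.

(** * Forests and components *)

Lemma set2_inj (T : finType) (x y z w : T) :
  [set x; y] = [set z; w] -> (x = z /\ y = w) \/ (x = w /\ y = z).
Proof.
move=> E.
have := set21 x y; rewrite E !inE => /orP xzw.
have := set22 x y; rewrite E !inE => /orP yzw.
have := set21 z w; rewrite -E !inE => /orP zxy.
have := set22 z w; rewrite -E !inE => /orP wxy.
by case: xzw => /eqP ?; case: yzw => /eqP ?; subst; auto;
  [case: wxy | case: zxy] => /eqP ?; subst; auto.
Qed.

Lemma adjacent_sym n (G : {set {set 'I_n}}) : symmetric (adjacent G).
Proof. by move=> x y; rewrite /adjacent setUC. Qed.

Lemma adjacent_connect_sym n (G : {set {set 'I_n}}) :
  connect_sym (adjacent G).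
Proof. exact/sym_connect_sym/adjacent_sym. Qed.

(** A walk that uses the new edge is cut at its first and last uses; what comes before and after
    lies in [A]. If these uses have opposite directions, [A] alone connects the ends. *)
Lemma connect_setU1 n (A : {set {set 'I_n}}) (x y u v : 'I_n) :
  connect (adjacent ([set x; y] |: A)) u v ->
  connect (adjacent A) u v \/
  (connect (adjacent A) u x /\ connect (adjacent A) y v) \/
  (connect (adjacent A) u y /\ connect (adjacent A) x v).
Proof.
case/connectP=> p; elim: p u => [|w p IH] u /=.
  by move=> _ ->; left; rewrite connect0.
case/andP=> uw wp ev; move: uw; rewrite /adjacent !inE => /orP[/eqP|uw].
  case/set2_inj=> -[eu ew]; subst u w; case: (IH _ wp ev) => [c|[[c1 c2]|[c1 c2]]].
  - by right; left; rewrite connect0.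
  - by right; left; rewrite connect0.
  - by left.
  - by right; right; rewrite connect0.
  - by left.
  - by right; right; rewrite connect0.
have /(@connect1 _ (adjacent A)) uw' : adjacent A u w by [].
case: (IH _ wp ev) => [c|[[c1 c2]|[c1 c2]]].
- by left; apply: connect_trans uw' c.
- by right; left; split=> //; apply: connect_trans uw' c1.
- by right; right; split=> //; apply: connect_trans uw' c1.
Qed.

(** A cycle of the larger graph must use the new edge, and the rest of that cycle would connect [x]
    and [y] within [A]. *)
Lemma acyclic_setU1 n (A : {set {set 'I_n}}) (x y : 'I_n) :
  acyclic_graph A -> ~~ connect (adjacent A) x y ->
  acyclic_graph ([set x; y] |: A).
Proof.
move=> acA nxy; apply/forallP=> k; apply/forallP=> s; apply/implyP=> k2.
apply/negP; rewrite /ucycleb => /andP[cs us].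
have szs : size s = k by rewrite size_tuple.
have ncA : ~~ cycle (adjacent A) s.
  by move/forallP/(_ k)/forallP/(_ s): acA; rewrite k2 /= /ucycleb us andbT.
have [u us' nu] : exists2 u, u \in (s : seq _) & ~~ adjacent A u (next s u).
  have [/existsP[u /andP[]]|/existsPn H] :=
    boolP [exists u, (u \in (s : seq _)) && ~~ adjacent A u (next s u)].
    by exists u.
  case/negP: ncA; apply: cycle_from_next => // u us'.
  by move/(_ u): H; rewrite us' /= negbK.
(* Rotated to start at [u], the cycle has the new edge as its first step, from [u] to [w]. *)
have [i s' es] := rot_to us'.
have us2 : uniq (u :: s') by rewrite -es rot_uniq.
have cs2 : cycle (adjacent ([set x; y] |: A)) (u :: s') by rewrite -es rot_cycle.
rewrite -(next_rot i us) es in nu.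
have sz2 : size (u :: s') = k by rewrite -es size_rot.
case: s' {es} us2 cs2 nu sz2 => [|w [|z p]]; [by move=> _ _ _ /= sk; lia..|].
rewrite /= eqxx !inE !negb_or => /and4P[/and3P[uw uz up] /andP[wz wp] zp pu].
rewrite {1}/adjacent in_setU1 => /and3P[uwe wze zpe] nuw _.
have {}uwe : [set u; w] = [set x; y].
  by case/orP: uwe => [/eqP //|]; rewrite -[_ \in A]/(adjacent A u w) (negbTE nuw).
(* The new edge ends at [w], so the part of the cycle that avoids [w] lies in [A]. *)
have sub : {in predC1 w &, subrel (adjacent ([set x; y] |: A)) (adjacent A)}.
  move=> a b; rewrite !inE => aw bw; rewrite {1}/adjacent in_setU1 -uwe.
  case/orP=> // /eqP eab.
  by have := set22 u w; rewrite -eab !inE !(eq_sym w) (negbTE aw) (negbTE bw).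
have zu : connect (adjacent A) z u.
  apply/connectP; exists (rcons p u); last by rewrite last_rcons.
  apply: (@sub_in_path _ (predC1 w) _ _ sub z (rcons p u)) zpe.
  rewrite /= eq_sym wz /= all_rcons /= uw /=.
  by apply/allP=> a ap; rewrite /=; apply: contraNneq wp => <-.
have wzA : adjacent A w z.
  move: wze; rewrite {1}/adjacent in_setU1 -uwe => /orP[/eqP e|//].
  by case/set2_inj: e => -[e1 e2]; [rewrite -e1 eqxx in uw | rewrite e2 eqxx in uz].
have wu : connect (adjacent A) w u := connect_trans (connect1 wzA) zu.
case/negP: nxy; case/set2_inj: uwe => -[<- <-] //.
by rewrite adjacent_connect_sym.
Qed.

Lemma acyclic_set0 n : acyclic_graph (set0 : {set {set 'I_n}}).
Proof.
apply/forallP=> k; apply/forallP=> -[[|x s] /= /eqP <-]; apply/implyP=> // _.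
by rewrite /ucycleb /=; case: s => [|y s] /=; rewrite /adjacent !inE.
Qed.

(** If an edge of [G] joined two components of a maximal acyclic set, [acyclic_setU1] would allow
    adding it. *)
Lemma maximal_forest n (A G : {set {set 'I_n}}) :
  A \subset G -> acyclic_graph A ->
  exists T : {set {set 'I_n}}, [/\ A \subset T, T \subset G, acyclic_graph T &
    forall x y, adjacent G x y -> connect (adjacent T) x y].
Proof.
move=> AG acA.
pose P := fun B : {set {set 'I_n}} => (B \subset G) && acyclic_graph B.
have PA : P A by rewrite /P AG.
have [T /maxsetP[/andP[TG acT] Tmax] AT] := maxset_exists PA.
exists T; split=> // x y xy; apply/negPn/negP=> nxy.
have := Tmax ([set x; y] |: T) _ (subsetUr _ _).
rewrite /P subUset sub1set TG acyclic_setU1 // !andbT => /(_ xy) E.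
by case/negP: nxy; apply: connect1; rewrite /adjacent -E setU11.
Qed.

Lemma spanning_tree_extend n (A G : {set {set 'I_n}}) :
  connected_graph G -> A \subset G -> acyclic_graph A ->
  exists2 T : {set {set 'I_n}}, A \subset T & spanning_tree G T.
Proof.
move=> cG AG acA; have [T [AT TG acT sub]] := maximal_forest AG acA.
exists T => //; rewrite /spanning_tree TG acT andbT /=.
apply/forallP=> x; apply/forallP=> y.
by apply: (connect_sub sub); move/forallP/(_ x)/forallP/(_ y): cG.
Qed.

Definition component n (A : {set {set 'I_n}}) (x : 'I_n) : {set 'I_n} :=
  [set y | connect (adjacent A) x y].

Definition components n (A : {set {set 'I_n}}) : {set {set 'I_n}} :=
  [set component A x | x in 'I_n].

Lemma eq_component n (A : {set {set 'I_n}}) x y :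
  (component A x == component A y) = connect (adjacent A) x y.
Proof.
apply/eqP/idP=> [E|xy].
  have : y \in component A y by rewrite inE.
  by rewrite -E inE.
apply/setP=> z; rewrite !inE; apply/idP/idP; last exact: connect_trans.
by apply: connect_trans; rewrite adjacent_connect_sym.
Qed.

Lemma components_partition n (A : {set {set 'I_n}}) :
  partition (components A) [set: 'I_n].
Proof.
rewrite /partition; apply/and3P; split.
- apply/eqP/setP=> x; rewrite inE; apply/bigcupP; exists (component A x).
    exact: imset_f.
  by rewrite inE connect0.
- apply/trivIsetP=> _ _ /imsetP[x _ ->] /imsetP[y _ ->]; rewrite eq_component => nxy.
  apply/pred0P=> z; rewrite /= !inE; apply/negP=> /andP[xz yz].
  by case/negP: nxy; apply: connect_trans xz _; rewrite adjacent_connect_sym.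
- apply/imsetP=> -[x _ /setP/(_ x)]; by rewrite !inE connect0.
Qed.

(** Induction on the number of edges: inserting an edge merges at most two components. *)
Lemma leq_components n (A : {set {set 'I_n}}) :
  simple_graph A -> n <= #|components A| + #|A|.
Proof.
move: {2}#|A| (erefl #|A|) => m; elim: m A => [|m IH] A cA sA.
  move/eqP: cA; rewrite cards_eq0 => /eqP ->; rewrite cards0 addn0 card_imset ?card_ord //.
  move=> x y /eqP; rewrite eq_component => /connectP[[|z p] /=]; first by [].
  by rewrite /adjacent inE.
have [e eA] : exists e, e \in A by apply/set0Pn; rewrite -cards_eq0 cA.
have /cards2P[x [y [_ ee]]] : #|e| == 2 by move/forallP/(_ e): sA; rewrite eA.
pose B := A :\ e.
have cB : #|B| = m by move: (cardsD1 e A); rewrite eA cA add1n => -[].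
have sB : simple_graph B.
  apply/forallP=> f; apply/implyP; rewrite !inE => /andP[_ fA].
  by move/forallP/(_ f): sA; rewrite fA.
have AB : A = [set x; y] |: B by rewrite -ee setD1K.
have := IH B cB sB; rewrite cA cB => le.
have {}le2 : #|components B :\ component B x| <= #|components A|; last first.
  move: (cardsD1 (component B x) (components B)) le le2; rewrite imset_f // add1n => -> le le2.
  by rewrite addnS -addSn (leq_trans le) // leq_add2r ltnS.
(* [f] sends a component of [B] to the component of [A] containing it. Only those of [x] and [y] can
   be merged, so [f] is injective once that of [x] is left out. *)
pose f (K : {set 'I_n}) := \bigcup_(z in K) component A z.
have subc u v : connect (adjacent B) u v -> connect (adjacent A) u v.
  apply: connect_sub => a b ab; apply: connect1; move: ab.
  by rewrite /adjacent AB !inE => ->; rewrite orbT.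
have fE z : f (component B z) = component A z.
  apply/setP=> w; apply/bigcupP/idP=> [[v]|zw].
    rewrite !inE => /subc; exact: connect_trans.
  by exists z; rewrite // inE connect0.
rewrite -(card_in_imset (f := f)); last first.
  move=> K K' /setD1P[nz /imsetP[z _ ez]] /setD1P[nw /imsetP[w _ ew]].
  move: nz nw; rewrite {}ez {}ew !eq_component => nz nw; rewrite !fE.
  move/eqP; rewrite eq_component AB => /connect_setU1 [zw|[[zx yw]|[zy xw]]].
  - by apply/eqP; rewrite eq_component.
  - by rewrite zx in nz.
  - by rewrite adjacent_connect_sym xw in nw.
apply: subset_leq_card; apply/subsetP=> _ /imsetP[K /setD1P[_ /imsetP[z _ ->]] ->].
by rewrite fE imset_f.
Qed.

(** * Sparsity and the size of a maximal forest *)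

Definition inner n (G : {set {set 'I_n}}) (S : {set 'I_n}) : {set {set 'I_n}} :=
  [set e in G | e \subset S].

Definition pairs n (S : {set 'I_n}) : {set {set 'I_n}} :=
  [set e : {set 'I_n} | (e \subset S) && (#|e| == 2)].

Definition dense_sets n (G : {set {set 'I_n}}) (L : nat) : {set {set 'I_n}} :=
  [set S : {set 'I_n} | #|S| <= L & #|S| <= #|inner G S|].

Lemma card_pairs n (S : {set 'I_n}) : #|pairs S| = 'C(#|S|, 2).
Proof. by rewrite -cards_draws; apply: eq_card => e; rewrite !inE. Qed.

Lemma simple_graphP n (G : {set {set 'I_n}}) e :
  simple_graph G -> e \in G -> #|e| = 2.
Proof. by move=> /forallP/(_ e)/implyP h eG; apply/eqP/h. Qed.

Lemma simple_graphS n (G F : {set {set 'I_n}}) :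
  F \subset G -> simple_graph G -> simple_graph F.
Proof.
move=> FG sG; apply/forallP=> e; apply/implyP=> eF.
by apply/eqP/(simple_graphP sG)/(subsetP FG).
Qed.

Lemma inner_pairs n (G : {set {set 'I_n}}) S :
  simple_graph G -> inner G S \subset pairs S.
Proof.
move=> sG; apply/subsetP=> e; rewrite !inE => /andP[eG ->] /=.
by rewrite (simple_graphP sG eG).
Qed.

Lemma innerS n (F G : {set {set 'I_n}}) S :
  F \subset G -> inner F S \subset inner G S.
Proof.
by move=> FG; apply/subsetP=> e; rewrite !inE => /andP[/(subsetP FG) -> ->].
Qed.

Lemma card_bigcup_le (I T : finType) (P : pred I) (F : I -> {set T}) :
  #|\bigcup_(i | P i) F i| <= \sum_(i | P i) #|F i|.
Proof.
elim/big_rec2: _ => [|i m A _ le]; first by rewrite cards0.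
by rewrite (leq_trans (leq_card_setU _ _)) // leq_add2l.
Qed.

(* In a component K of A, F has at most |K| - 1 edges as soon as K is small and not
   dense; the components with more than L vertices are handled together, through
   the sparsity of their union B. *)
Lemma forest_excess n (G F A : {set {set 'I_n}}) (L z : nat) :
  simple_graph G -> F \subset G -> A \subset F -> 0 < L ->
  (forall x y, adjacent F x y -> connect (adjacent A) x y) ->
  (forall B : {set 'I_n}, #|B| <= 2 * #|F| -> #|inner G B| <= #|B| + z) ->
  L * #|F| <= L * (#|A| + z + L ^ 2 * #|dense_sets G L|) + 2 * #|F|.
Proof.
move=> sG FG AF L0 FA sparse.
have sF := simple_graphS FG sG; have sA := simple_graphS AF sF.
pose P := components A.
pose Lg := [set K in P | L < #|K|]; pose Sm := [set K in P | #|K| <= L].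
have partP := components_partition A; have trivP : trivIset P by case/and3P: partP.
pose B := cover Lg.
have Sum_B : #|B| = \sum_(K in Lg) #|K|.
  apply/esym/eqP; rewrite -/(trivIset _); apply: trivIsetS trivP.
  by apply/subsetP=> K; rewrite inE => /andP[].
have sumn : n = #|B| + \sum_(K in Sm) #|K|.
  have := card_partition partP; rewrite cardsT card_ord => {1}->.
  rewrite (bigID (fun K : {set 'I_n} => L < #|K|)) /= Sum_B; congr (_ + _);
    by apply: eq_bigl => K; rewrite inE // -leqNgt.
have cardP : #|P| = #|Lg| + #|Sm|.
  rewrite -(cardsID [set K : {set 'I_n} | L < #|K|] P); congr (_ + _);
    by apply: eq_card => K; rewrite !inE // -leqNgt andbC.
(* A component with more than [L] vertices has at least two, so each of its vertices lies on an edge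
   of [A], and an edge covers only two vertices. *)
have B2F : #|B| <= 2 * #|F|.
  suff /subset_leq_card le : B \subset \bigcup_(e in A) e.
    apply: leq_trans le _; apply: leq_trans (card_bigcup_le _ _) _.
    rewrite (eq_bigr (fun=> 2)) => [|e /(simple_graphP sA) //].
    by rewrite sum_nat_const mulnC leq_mul2l subset_leq_card.
  apply/subsetP=> x /bigcupP[K]; rewrite inE => /andP[/imsetP[y _ ->] lt].
  move=> xy; have lt1 : 1 < #|component A y| by apply: leq_trans lt.
  case/card_gt1P: lt1 => [u [v [uy vy uv]]].
  have [w wy wx] : exists2 w, w \in component A y & x != w.
    by case: (eqVneq x u) => [->|xu]; [exists v | exists u].
  have : connect (adjacent A) x w.
    move: xy wy; rewrite !inE adjacent_connect_sym; exact: connect_trans.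
  case/connectP=> -[|c p] /= => [_ e|/andP[xc _] _]; first by rewrite e eqxx in wx.
  by apply/bigcupP; exists [set x; c]; rewrite ?set21.
have leF : #|F| <= #|inner F B| + \sum_(K in Sm) #|inner F K|.
  suff /subset_leq_card le : F \subset inner F B :|: \bigcup_(K in Sm) inner F K.
    apply: leq_trans le _; apply: leq_trans (leq_card_setU _ _) _.
    by rewrite leq_add2l card_bigcup_le.
  apply/subsetP=> e eF; have /eqP/cards2P[x [y [_ ee]]] := simple_graphP sF eF.
  have eK : e \subset component A x.
    by rewrite ee subUset !sub1set !inE connect0 /= FA // /adjacent -ee.
  rewrite inE; have [lt|le] := ltnP L #|component A x|; apply/orP; [left|right].
    rewrite inE eF /=; apply: (bigcup_max (component A x)) => //.
    by rewrite inE lt andbT imset_f.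
  by apply/bigcupP; exists (component A x); rewrite inE ?eF // imset_f.
(* A small component [K] spans at most |K| - 1 edges of [F] unless it is dense; a dense one is
   charged the crude bound L^2. *)
have small : \sum_(K in Sm) #|inner F K| + #|Sm| <=
             \sum_(K in Sm) #|K| + L ^ 2 * #|dense_sets G L|.
  have -> : #|dense_sets G L| = \sum_(K in dense_sets G L) 1 by rewrite sum1_card.
  have le : \sum_(K in Sm) (K \in dense_sets G L) <= \sum_(K in dense_sets G L) 1.
    rewrite -big_mkcondr /= big_mkcond [leqRHS]big_mkcond /=.
    by apply: leq_sum => K _; case: (K \in Sm).
  apply: leq_trans (leq_add (leqnn _) (leq_mul (leqnn _) le)).
  rewrite -sum1_card big_distrr -!big_split /=; apply: leq_sum => K.
  rewrite inE => /andP[/imsetP[x _ eK] KL].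
  have K0 : 0 < #|K| by rewrite card_gt0; apply/set0Pn; exists x; rewrite eK inE.
  have [Kd|] := boolP (K \in _).
    have le1 : #|inner F K| <= L ^ 2.
      apply: leq_trans (subset_leq_card (inner_pairs _ sF)) _.
      rewrite card_pairs bin2; have : #|K| * #|K|.-1 <= L ^ 2.
        by rewrite -mulnn leq_mul // (leq_trans (leq_pred _)).
      by apply: leq_trans; rewrite -[leqRHS]doubleK -addnn half_leq // leq_addr.
    by rewrite muln1 addnC leq_add.
  rewrite !inE KL /= -ltnNge muln0 addn0 addn1.
  by apply: leq_ltn_trans; apply: subset_leq_card (innerS _ FG).
have largeL : L * #|Lg| <= #|B|.
  rewrite mulnC Sum_B -sum_nat_const; apply: leq_sum => K.
  by rewrite inE => /andP[_ /ltnW].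
have leBz : #|inner F B| <= #|B| + z.
  by apply: leq_trans (sparse _ B2F); apply: subset_leq_card (innerS _ FG).
(* The sizes of the components sum to [n], which is at most |A| plus the number of components. The
   small components cancel, and at most |B| / L <= 2|F| / L large ones remain. *)
have leA := leq_components sA; rewrite -/P cardP in leA.
have : #|F| <= #|A| + z + L ^ 2 * #|dense_sets G L| + #|Lg| by lia.
move=> le; apply: leq_trans (leq_mul (leqnn L) le) _.
by rewrite mulnDr leq_add2l (leq_trans largeL).
Qed.

(** * Switchings *)

Lemma regular_graphsP d n (G : {set {set 'I_n}}) :
  reflect (simple_graph G /\ forall v, degree G v = d) (G \in regular_graphs d n).
Proof.
rewrite inE; apply: (iffP andP) => -[sG dG]; split=> //.
  by move=> v; apply/eqP; move/forallP: dG.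
by apply/forallP=> v; apply/eqP.
Qed.

Definition neighbours n (G : {set {set 'I_n}}) (x : 'I_n) : {set 'I_n} :=
  [set y | adjacent G x y].

Lemma adjacent_neq n (G : {set {set 'I_n}}) x y :
  simple_graph G -> adjacent G x y -> x != y.
Proof.
move=> sG /(simple_graphP sG); rewrite cards2; by case: eqP.
Qed.

Lemma card_neighbours n (G : {set {set 'I_n}}) x :
  simple_graph G -> #|neighbours G x| = degree G x.
Proof.
move=> sG; rewrite /degree -(card_in_imset (f := fun y => [set x; y])).
  apply: eq_card => e; rewrite inE; apply/imsetP/andP.
    by move=> [y]; rewrite inE => xy ->; rewrite set21.
  move=> [eG xe]; have /eqP/cards2P[a [b [_ ee]]] := simple_graphP sG eG.
  move: xe; rewrite ee !inE => /orP[]/eqP exx; subst x.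
    by exists b; rewrite // inE /adjacent -ee.
  by exists a; rewrite ?inE /adjacent setUC -?ee // -ee.
move=> y z; rewrite !inE => xy xz /set2_inj[[]//|[<- e]].
by have := adjacent_neq sG xy; rewrite e eqxx.
Qed.

Definition arcs n (E : {set {set 'I_n}}) : {set 'I_n * 'I_n} :=
  [set p | adjacent E p.1 p.2].

Lemma card_dep_pairs (T W : finType) (Z : {set T}) (C : T -> {set W}) :
  #|[set p : T * W | (p.1 \in Z) && (p.2 \in C p.1)]| = \sum_(t in Z) #|C t|.
Proof.
rewrite -sum1_card (eq_bigl (fun p : T * W => (p.1 \in Z) && (p.2 \in C p.1))).
  rewrite -(pair_big_dep (mem Z) (fun t w => w \in C t) (fun _ _ => 1)) /=.
  by apply: eq_bigr => t _; rewrite sum1_card.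
by move=> p; rewrite inE.
Qed.

Lemma card_arcs_from n (G : {set {set 'I_n}}) d (S : {set 'I_n}) :
  G \in regular_graphs d n -> #|[set p in arcs G | p.1 \in S]| = #|S| * d.
Proof.
move=> /regular_graphsP[sG dG].
have -> : [set p in arcs G | p.1 \in S] =
    [set p | (p.1 \in S) && (p.2 \in neighbours G p.1)].
  by apply/setP=> p; rewrite !inE andbC.
rewrite card_dep_pairs -sum_nat_const; apply: eq_bigr => x _.
by rewrite card_neighbours.
Qed.

Lemma arcs_swap n (G : {set {set 'I_n}}) (P : pred 'I_n) :
  #|[set p in arcs G | P p.2]| = #|[set p in arcs G | P p.1]|.
Proof.
rewrite -(card_imset (f := fun p : 'I_n * 'I_n => (p.2, p.1))); last first.
  by move=> [a b] [c e] [-> ->].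
apply: eq_card => -[x y]; apply/imsetP/idP.
  by move=> [[a b]]; rewrite !inE /= adjacent_sym => h [-> ->].
by rewrite !inE /= adjacent_sym => h; exists (y, x); rewrite // !inE.
Qed.

Lemma card_arcs n (G : {set {set 'I_n}}) d :
  G \in regular_graphs d n -> #|arcs G| = d * n.
Proof.
move=> /(card_arcs_from setT); rewrite cardsT card_ord mulnC => <-.
by apply: eq_card => p; rewrite !inE andbT.
Qed.

Lemma card_arcs_simple n (G : {set {set 'I_n}}) :
  simple_graph G -> #|arcs G| = 2 * #|G|.
Proof.
move=> sG.
rewrite -sum1_card (partition_big (fun p => [set p.1; p.2]) (mem G)) /=; last first.
  by move=> p; rewrite inE.
rewrite mulnC -sum_nat_const; apply: eq_bigr => e eG.
rewrite (eq_bigl [in [set p : 'I_n * 'I_n | [set p.1; p.2] == e]]); last first.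
  by move=> p; rewrite !inE /adjacent; case: eqP => [->|]; rewrite ?eG ?andbF.
rewrite sum1_card.
have /eqP/cards2P[x [y [xy ee]]] := simple_graphP sG eG.
rewrite (_ : [set p | _] = [set (x, y); (y, x)]) ?cards2 ?xpair_eqE ?(negbTE xy) //.
apply/setP=> -[a b]; rewrite !inE /= ee !xpair_eqE; apply/eqP/orP.
  by case/set2_inj=> -[-> ->]; rewrite !eqxx; auto.
by case=> /andP[/eqP-> /eqP->] //; rewrite setUC.
Qed.

Lemma card_regular_graph n (G : {set {set 'I_n}}) d :
  G \in regular_graphs d n -> 2 * #|G| = d * n.
Proof.
move=> Gr; rewrite -(card_arcs Gr) card_arcs_simple //.
by case/regular_graphsP: Gr.
Qed.

Lemma degree_setU1 n (G : {set {set 'I_n}}) e v :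
  e \notin G -> degree (e |: G) v = (v \in e) + degree G v.
Proof.
move=> eG; rewrite /degree (cardsD1 e) !inE eqxx /=; congr (_ + _).
apply: eq_card => f; rewrite !inE.
by case: (eqVneq f e) => [->|] //=; rewrite (negbTE eG).
Qed.

Definition switch n (G : {set {set 'I_n}}) (u v x y : 'I_n) : {set {set 'I_n}} :=
  [set u; x] |: ([set v; y] |: (G :\ [set u; v] :\ [set x; y])).

Section Switch.
Variables (d n : nat) (G : {set {set 'I_n}}) (u v x y : 'I_n).
Hypotheses (Gr : G \in regular_graphs d n) (uv : adjacent G u v)
  (xy : adjacent G x y) (ux : ~~ adjacent G u x) (vy : ~~ adjacent G v y)
  (nux : u != x) (nvy : v != y).

Let sG : simple_graph G. Proof. by case/regular_graphsP: Gr. Qed.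
Let nuv : u != v. Proof. exact: adjacent_neq uv. Qed.
Let nxy : x != y. Proof. exact: adjacent_neq xy. Qed.
(** If [u = y], then [ux] would be the edge [xy] of [G]; if [v = x], it would be the edge [uv]. *)
Let nuy : u != y.
Proof. by apply: contraNneq ux => ->; rewrite adjacent_sym. Qed.
Let nvx : v != x.
Proof. by apply: contraNneq ux => <-. Qed.

Let H := G :\ [set u; v] :\ [set x; y].

Let e1 : [set u; v] != [set x; y].
Proof.
by apply/eqP=> /set2_inj[[e _]|[e _]]; move: nux nuy; rewrite e eqxx.
Qed.
Let e2 : [set u; x] != [set v; y].
Proof.
by apply/eqP=> /set2_inj[[e _]|[e _]]; move: nuv nuy; rewrite e eqxx.
Qed.
Let uxG : [set u; x] \notin G. Proof. exact: ux. Qed.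
Let vyG : [set v; y] \notin G. Proof. exact: vy. Qed.

(** Each of the four vertices loses one edge and gains one, so degrees are compared over the common
    part [H]. *)
Lemma switch_regular : switch G u v x y \in regular_graphs d n.
Proof.
have GE : G = [set u; v] |: ([set x; y] |: H).
  by rewrite /H setD1K ?setD1K // !inE eq_sym e1; exact: xy.
apply/regular_graphsP; split.
  apply/forallP=> e; apply/implyP; rewrite !inE => /or3P[/eqP->|/eqP->|].
  - by rewrite cards2 nux.
  - by rewrite cards2 nvy.
  - by move=> /and3P[_ _ /(simple_graphP sG) ->].
move=> w; case/regular_graphsP: (Gr) => _ /(_ w) <-; rewrite {2}GE /switch -/H.
rewrite !degree_setU1 !inE ?(negbTE e1) ?(negbTE e2) ?eqxx ?(negbTE uxG) ?(negbTE vyG) ?andbF //=.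
have [->|wu] := eqVneq w u; first by rewrite (negbTE nux) (negbTE nuy) (negbTE nuv).
have [->|wv] := eqVneq w v; first by rewrite (negbTE nvx) (negbTE nvy).
by have [->|wx] := eqVneq w x; first by rewrite (negbTE nxy).
Qed.

Lemma switchK : switch (switch G u v x y) u x v y = G.
Proof.
apply/setP=> e; rewrite !inE.
have [->|ne1] := eqVneq e [set u; v]; first by rewrite (_ : _ \in G).
have [->|ne2] := eqVneq e [set x; y]; first by rewrite (_ : _ \in G).
have [->|ne3] := eqVneq e [set u; x]; first by rewrite andbF (negbTE uxG).
by have [->|ne4] := eqVneq e [set v; y]; first by rewrite (negbTE vyG).
Qed.

Lemma switch_subset (F : {set {set 'I_n}}) :
  F \subset G -> [set u; v] \notin F -> [set x; y] \notin F ->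
  F \subset switch G u v x y.
Proof.
move=> FG uvF xyF; apply/subsetP=> e eF; rewrite !inE (subsetP FG) // andbT.
have -> : e != [set u; v] by apply: contraTneq eF => ->.
have -> : e != [set x; y] by apply: contraTneq eF => ->.
by rewrite !orbT.
Qed.

Lemma adjacent_switch a b : adjacent (switch G u v x y) a b =
  [|| [set a; b] == [set u; x], [set a; b] == [set v; y] |
   [&& [set a; b] != [set x; y], [set a; b] != [set u; v] & adjacent G a b]].
Proof. by rewrite /adjacent !inE. Qed.
End Switch.

(** The map (t, w) -> (f t w, w) injects the pairs over [X] into those over [Y]. The label [w]
    records the vertices of a switching, so that it can be undone. *)
Lemma double_count (T1 T2 W : finType) (X : {set T1}) (Y : {set T2})
    (A : T1 -> {set W}) (B : T2 -> {set W}) (f : T1 -> W -> T2) (a b : nat) :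
  (forall t w, t \in X -> w \in A t -> (f t w \in Y) && (w \in B (f t w))) ->
  (forall t t' w, t \in X -> t' \in X -> w \in A t -> w \in A t' ->
     f t w = f t' w -> t = t') ->
  (forall t, t \in X -> a <= #|A t|) -> (forall t, t \in Y -> #|B t| <= b) ->
  #|X| * a <= #|Y| * b.
Proof.
move=> fXY finj aA Bb.
apply: (@leq_trans (\sum_(t in X) #|A t|)).
  by rewrite -sum_nat_const; apply: leq_sum.
apply: (@leq_trans (\sum_(t in Y) #|B t|)); last first.
  by rewrite -sum_nat_const; apply: leq_sum.
rewrite -!card_dep_pairs -(card_in_imset (f := fun p : T1 * W => (f p.1 p.2, p.2))).
  apply: subset_leq_card; apply/subsetP=> q /imsetP[[t w]]; rewrite inE /= => /andP[tX wA] ->.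
  by rewrite inE /= fXY.
move=> [t w] [t' w']; rewrite !inE /= => /andP[tX wA] /andP[t'X w'A] [ef ew].
by subst w'; rewrite (finj t t' w).
Qed.

(** * Graphs containing a given edge set *)

Definition supergraphs d n (F : {set {set 'I_n}}) : {set {set {set 'I_n}}} :=
  [set G in regular_graphs d n | F \subset G].

(* Switch the edge uv of G with an arc (x, y) of G outside F: almost all of the
   d n arcs are allowed, and each resulting graph arises from at most d * d arcs. *)
Lemma card_supergraphs_setU1 d n (F : {set {set 'I_n}}) u v :
  [set u; v] \notin F ->
  #|supergraphs d ([set u; v] |: F)| * (d * n - (2 * #|F| + 2 + 2 * (d * d.+1)))
    <= #|supergraphs d F| * (d * d).
Proof.
move=> uvF.
pose A (G : {set {set 'I_n}}) := [set p in arcs G | [&& p \notin arcs ([set u; v] |: F),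
   p.1 \notin u |: neighbours G u & p.2 \notin v |: neighbours G v]].
pose B (G : {set {set 'I_n}}) := setX (neighbours G u) (neighbours G v).
pose f (G : {set {set 'I_n}}) (p : 'I_n * 'I_n) := switch G u v p.1 p.2.
have AP G x y : (x, y) \in A G -> [/\ adjacent G x y, [set x; y] \notin F,
    ~~ adjacent G u x, ~~ adjacent G v y & (u != x) && (v != y)].
  rewrite !inE !negb_or /= => /and4P[xy xyF /andP[xu ux] /andP[yv vy]].
  rewrite eq_sym xu eq_sym yv; split=> //.
  by move: xyF; rewrite /adjacent !inE negb_or => /andP[].
apply: (@double_count _ _ _ _ _ A B f).
- move=> G [x y] /setIdP[Gr]; rewrite subUset sub1set => /andP[uv FG].
  case/AP=> xy xyF ux vy /andP[xu yv].
  rewrite inE /f /= switch_regular ?switch_subset //=.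
  by rewrite !inE /= !adjacent_switch !eqxx ?orbT.
- move=> G G' [x y] /setIdP[Gr]; rewrite subUset sub1set => /andP[uv _].
  move=> /setIdP[Gr']; rewrite subUset sub1set => /andP[uv' _].
  move=> /AP[xy _ ux vy /andP[xu yv]] /AP[xy' _ ux' vy' _]; rewrite /f /= => e.
  by rewrite -(switchK uv xy ux vy) e switchK.
- move=> G /setIdP[Gr uvFG]; have [sG dG] := regular_graphsP _ _ Gr.
  have cN w : #|w |: neighbours G w| <= d.+1.
    by rewrite (leq_trans (leq_card_setU _ _)) // cards1 card_neighbours // dG.
  rewrite leq_subLR -(card_arcs Gr).
  (* Besides the arcs of [F] and of [uv], the excluded arcs start in the closed neighbourhood of [u]
     or end in that of [v]; each of these has at most d + 1 vertices. *)
  pose X := [set p in arcs G | p.1 \in u |: neighbours G u].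
  pose Y := [set p in arcs G | p.2 \in v |: neighbours G v].
  have cX : #|X| <= d * d.+1 by rewrite (card_arcs_from _ Gr) mulnC leq_mul2l cN orbT.
  have cY : #|Y| <= d * d.+1.
    rewrite /Y (arcs_swap G (mem (v |: neighbours G v))).
    by rewrite (card_arcs_from _ Gr) mulnC leq_mul2l cN orbT.
  have cF : #|arcs ([set u; v] |: F)| <= 2 * #|F| + 2.
    rewrite card_arcs_simple ?(simple_graphS uvFG) // cardsU1 uvF; lia.
  have /subset_leq_card le : arcs G \subset A G :|: (arcs ([set u; v] |: F) :|: (X :|: Y)).
    apply/subsetP=> p pG.
    rewrite 3!in_setU [p \in A G]inE [p \in X]inE [p \in Y]inE pG /=.
    by case: (p \in arcs _) => //=; case: (p.1 \in _) => //=; case: (p.2 \in _).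
  rewrite addnC (leq_trans le) // (leq_trans (leq_card_setU _ _)) // leq_add2l.
  rewrite (leq_trans (leq_card_setU _ _)) // leq_add // mul2n -addnn.
  by rewrite (leq_trans (leq_card_setU _ _)) // leq_add.
- move=> G; rewrite inE => /andP[/regular_graphsP[sG dG] _].
  by rewrite cardsX !card_neighbours // !dG.
Qed.

(** The edges of [F] are removed one at a time. The hypothesis keeps at least dn / 2 arcs allowed,
    so each edge contributes a factor d^2 / (dn / 2) = 2d / n. *)
Lemma card_supergraphs_le d n (F : {set {set 'I_n}}) :
  2 * (2 * #|F| + 2 * (d * d.+1)) <= d * n ->
  #|supergraphs d F| * n ^ #|F| <= (2 * d) ^ #|F| * #|regular_graphs d n|.
Proof.
move: {2}#|F| (erefl #|F|) => m; elim: m F => [|m IH] F cF le.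
  rewrite cF muln1 mul1n subset_leq_card //.
  by apply/subsetP=> G; rewrite inE => /andP[].
(* If no graph contains [F] the bound is trivial; otherwise such a graph shows that the elements of
   [F] are pairs of vertices. *)
have [->|[G]] := set_0Vmem (supergraphs d F); first by rewrite cards0.
move=> /setIdP[Gr FG]; have [sG dG] := regular_graphsP _ _ Gr.
have [e eF] : exists e, e \in F by apply/set0Pn; rewrite -cards_eq0 cF.
have /eqP/cards2P[u [v [_ ee]]] := simple_graphP sG (subsetP FG _ eF).
have cE : #|F :\ e| = m by move: (cardsD1 e F); rewrite eF cF add1n => -[].
have FE : F = [set u; v] |: (F :\ e) by rewrite -ee setD1K.
have := @card_supergraphs_setU1 d n (F :\ e) u v; rewrite -FE cE -ee !inE eqxx => /(_ isT) le1.
have {}IH := IH (F :\ e) cE; rewrite cE in IH; rewrite cF in le *.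
have {}IH := IH ltac:(lia).
set N := #|regular_graphs d n| in IH *; set a := #|supergraphs d F| in le1 *.
set b := #|supergraphs d _| in le1 IH.
have [d0|d0] := posnP d.
  move: Gr; rewrite {1}d0 => /card_regular_graph; rewrite mul0n => /eqP.
  rewrite muln_eq0 cards_eq0 /= => /eqP G0.
  by move: (subsetP FG e eF); rewrite G0 inE.
have {le1} le2 : a * n <= 2 * d * b.
  rewrite -(leq_pmul2l d0).
  have : a * (d * n) <= a * (2 * (d * n - (2 * m + 2 + 2 * (d * d.+1)))).
    by rewrite leq_mul2l; apply/orP; right; lia.
  move=> h; have -> : d * (a * n) = a * (d * n) by lia.
  apply: leq_trans h _; have -> : d * (2 * d * b) = 2 * (b * (d * d)) by lia.
  by rewrite mulnCA leq_mul2l le1.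
rewrite !expnS mulnA; apply: leq_trans (leq_mul le2 (leqnn _)) _.
by rewrite -!mulnA leq_mul2l; apply/orP; right; rewrite leq_mul2l IH orbT.
Qed.

(** * Graphs classified by the size of a cut *)

(** Only arcs leaving [S] are listed, so an edge of the cut counts once, whereas [arcs_in] lists
    each inner edge twice. *)
Definition crossing n (G : {set {set 'I_n}}) (S : {set 'I_n}) : {set 'I_n * 'I_n} :=
  [set p in arcs G | (p.1 \in S) && (p.2 \notin S)].

Definition cut_graphs d n (S : {set 'I_n}) (j : nat) : {set {set {set 'I_n}}} :=
  [set G in regular_graphs d n | #|crossing G S| == j].

Definition arcs_in n (G : {set {set 'I_n}}) (S : {set 'I_n}) : {set 'I_n * 'I_n} :=
  [set p in arcs G | (p.1 \in S) && (p.2 \in S)].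

Lemma card_arcs_in d n (G : {set {set 'I_n}}) S :
  G \in regular_graphs d n -> #|arcs_in G S| + #|crossing G S| = #|S| * d.
Proof.
move=> Gr; rewrite -(card_arcs_from S Gr) 
  -(cardsID [set p : 'I_n * 'I_n | p.2 \in S] [set p in arcs G | p.1 \in S]).
by congr (_ + _); apply: eq_card => p; rewrite !inE andbA // andbC.
Qed.

Lemma crossingC n (G : {set {set 'I_n}}) S :
  #|crossing G (~: S)| = #|crossing G S|.
Proof.
rewrite -(card_imset (f := fun p : 'I_n * 'I_n => (p.2, p.1))); last first.
  by move=> [a b] [c e] [-> ->].
apply: eq_card => -[x y]; apply/imsetP/idP.
  by move=> [[a b]]; rewrite !inE /= adjacent_sym negbK andbC [X in X && _]andbC andbC => h [-> ->].
rewrite !inE /= adjacent_sym => /and3P[h1 h2 h3]; exists (y, x) => //.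
by rewrite !inE /= h1 h2 h3.
Qed.

(* Switch an edge uv inside S with an edge xy outside S. *)
Lemma card_cut_graphs_step d n (S : {set 'I_n}) j :
  #|cut_graphs d S j| *
    ((#|S| * d - j) * ((n - #|S|) * d - j) - (j * (d * d) + j * (d * d)))
  <= #|cut_graphs d S j.+2| * (j.+2 * j.+1).
Proof.
pose In (G : {set {set 'I_n}}) := setX (arcs_in G S) (arcs_in G (~: S)).
(* [E1] and [E2] collect the choices that are blocked because [ux], respectively [vy], is already an
   edge. *)
pose E1 (G : {set {set 'I_n}}) :=
  [set w : ('I_n * 'I_n) * ('I_n * 'I_n) | (w \in In G) && adjacent G w.1.1 w.2.1].
pose E2 (G : {set {set 'I_n}}) :=
  [set w : ('I_n * 'I_n) * ('I_n * 'I_n) | (w \in In G) && adjacent G w.1.2 w.2.2].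
pose A (G : {set {set 'I_n}}) := In G :\: (E1 G :|: E2 G).
(* A switching is undone by choosing the crossing arcs (u, x) and (v, y) in order; they are distinct
   since [u] and [v] are, which leaves at most (j + 2)(j + 1) choices. *)
pose B (G : {set {set 'I_n}}) := [set w : ('I_n * 'I_n) * ('I_n * 'I_n) |
  [&& (w.1.1, w.2.1) \in crossing G S, (w.1.2, w.2.2) \in crossing G S & w.1.1 != w.1.2]].
pose f (G : {set {set 'I_n}}) (w : ('I_n * 'I_n) * ('I_n * 'I_n)) :=
  switch G w.1.1 w.1.2 w.2.1 w.2.2.
have AP G u v x y : ((u, v), (x, y)) \in A G ->
    [/\ [/\ u \in S, v \in S, x \notin S & y \notin S], adjacent G u v, adjacent G x y,
        ~~ adjacent G u x & ~~ adjacent G v y].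
  rewrite !inE /= => /andP[nE /andP[/and3P[uv uS vS] /and3P[xy xS yS]]].
  by move: nE; rewrite uv uS vS xy xS yS /= negb_or => /andP[].
have neqS a b : a \in S -> b \notin S -> a != b by move=> aS; apply: contraNneq => <-.
apply: (@double_count _ _ _ _ _ A B f).
- move=> G [[u v] [x y]] /setIdP[Gr /eqP cj] /AP[[uS vS xS yS] uv xy ux vy].
  have [sG _] := regular_graphsP _ _ Gr; have nuv := adjacent_neq sG uv.
  have nux := neqS _ _ uS xS; have nvy := neqS _ _ vS yS.
  have E : crossing (switch G u v x y) S = (u, x) |: ((v, y) |: crossing G S).
    apply/setP=> -[a b]; rewrite !inE /= adjacent_switch !xpair_eqE.
    apply/idP/idP.
      case/andP=> + /andP[aS bS]; rewrite aS bS.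
      case/or3P=> [/eqP/set2_inj[[-> ->]|[e _]]|/eqP/set2_inj[[-> ->]|[e _]]|/and3P[_ _ ->]];
        rewrite ?eqxx ?orbT //; [by rewrite e (negbTE xS) in aS | by rewrite e (negbTE yS) in aS].
    case/or3P=> [/andP[/eqP-> /eqP->]|/andP[/eqP-> /eqP->]|/and3P[ab aS bS]];
      rewrite ?eqxx ?uS ?vS ?xS ?yS ?orbT //= aS bS ab !andbT.
    apply/orP; right; apply/orP; right; apply/andP; split.
      by apply: contraTneq aS => e; have := set21 a b; rewrite e !inE => /orP[]/eqP->.
    by apply: contraNneq bS => e; have := set22 a b; rewrite e !inE => /orP[]/eqP->.
  rewrite inE switch_regular //= [B _]/B inE /f /= E !cardsU1 !inE !eqxx /= nuv ?orbT !andbT.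
  by rewrite xpair_eqE (negbTE nuv) /= (negbTE ux) (negbTE vy) /= cj.
- move=> G G' [[u v] [x y]] /setIdP[Gr _] /setIdP[Gr' _].
  move=> /AP[[uS vS xS yS] uv xy ux vy] /AP[_ uv' xy' ux' vy'].
  have nux := neqS _ _ uS xS; have nvy := neqS _ _ vS yS; rewrite /f /= => e.
  by rewrite -(switchK uv xy ux vy) e switchK.
- move=> G /setIdP[Gr /eqP cj]; have [sG dG] := regular_graphsP _ _ Gr.
  have c1 : #|arcs_in G S| = #|S| * d - j by rewrite -(card_arcs_in S Gr) cj addnK.
  have c2 : #|arcs_in G (~: S)| = (n - #|S|) * d - j.
    have <- : #|~: S| = n - #|S| by rewrite [LHS]cardsCs setCK card_ord.
    by rewrite -(card_arcs_in _ Gr) crossingC cj addnK.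
  (* A blocked choice is determined by a crossing arc, (u, x) or (v, y), and a neighbour of each of
     its ends. *)
  have cdep : #|[set p : ('I_n * 'I_n) * ('I_n * 'I_n) | (p.1 \in crossing G S) &&
      (p.2 \in setX (neighbours G p.1.1) (neighbours G p.1.2))]| = j * (d * d).
    rewrite (card_dep_pairs (crossing G S)
      (fun p => setX (neighbours G p.1) (neighbours G p.2))) -cj -sum_nat_const.
    apply: eq_bigr => p _.
    by rewrite cardsX !card_neighbours // !dG.
  have cE1 : #|E1 G| <= j * (d * d).
    rewrite -cdep -(card_imset (f := fun w : ('I_n * 'I_n) * ('I_n * 'I_n) =>
      ((w.1.1, w.2.1), (w.1.2, w.2.2)))); last first.
      by move=> [[? ?] [? ?]] [[? ?] [? ?]] [-> -> -> ->].
    apply: subset_leq_card; apply/subsetP=> q /imsetP[[[u v] [x y]] h ->]; move: h.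
    by rewrite !inE /= => /andP[/andP[/and3P[-> -> vS] /and3P[-> -> yS]] ->].
  have cE2 : #|E2 G| <= j * (d * d).
    rewrite -cdep -(card_imset (f := fun w : ('I_n * 'I_n) * ('I_n * 'I_n) =>
      ((w.1.2, w.2.2), (w.1.1, w.2.1)))); last first.
      by move=> [[? ?] [? ?]] [[? ?] [? ?]] [-> -> -> ->].
    apply: subset_leq_card; apply/subsetP=> q /imsetP[[[u v] [x y]] h ->]; move: h.
    rewrite !inE /= => /andP[/andP[/and3P[uv uS ->] /and3P[xy xS ->]] ->] /=.
    by rewrite adjacent_sym uv adjacent_sym xy.
  rewrite -c1 -c2 -cardsX -/(In G) /A cardsDS; last first.
    by apply/subsetP=> w; rewrite in_setU [w \in E1 G]inE [w \in E2 G]inE => /orP[]/andP[].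
  apply: leq_sub2l; apply: leq_trans (leq_card_setU _ _) _; exact: leq_add.
- move=> G /setIdP[Gr /eqP cj].
  have -> : j.+2 * j.+1 = #|[set p : ('I_n * 'I_n) * ('I_n * 'I_n) |
      (p.1 \in crossing G S) && (p.2 \in crossing G S :\ p.1)]|.
    rewrite (card_dep_pairs (crossing G S) (fun p => crossing G S :\ p)) -{1}cj.
    rewrite -sum_nat_const; apply: eq_bigr => p pc.
    by have := cardsD1 p (crossing G S); rewrite pc cj add1n => -[].
  rewrite -(card_imset (B G) (f := fun w : ('I_n * 'I_n) * ('I_n * 'I_n) =>
      ((w.1.1, w.2.1), (w.1.2, w.2.2)))); last first.
    by move=> [[? ?] [? ?]] [[? ?] [? ?]] [-> -> -> ->].
  apply: subset_leq_card; apply/subsetP=> q /imsetP[[[u v] [x y]] h ->]; move: h.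
  rewrite [_ \in B G]inE /= => /and3P[h1 h2 h3]; rewrite inE /= h1 in_setD1 h2 xpair_eqE.
  by rewrite eq_sym (negbTE h3).
Qed.

(* The right-hand side counts the switchings raising the number of edges leaving
   a k-set from 2i to 2i + 2. Since d / 2 >= 3 / 2 leaves room above 5 / 4, the
   error terms are absorbed by enlarging k and n - k by a quarter only. *)
Lemma switch_count_bound d n k i :
  2 < d -> k.*2 <= n -> 40 * (d * d) <= n -> i < k + k %/ 4 ->
  4 * ((k + k %/ 4 - i) * (n - k + (n - k) %/ 4 - i)) <=
  (k * d - i.*2) * ((n - k) * d - i.*2) - (i.*2 * (d * d) + i.*2 * (d * d)).
Proof.
move=> d3 kn nd ik.
set k' := n - k; set a := k %/ 4; set b := k' %/ 4.
have ka : 4 * a <= k by rewrite mulnC leq_trunc_div.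
have kb : 4 * b <= k' by rewrite mulnC leq_trunc_div.
have kk : k <= k' by lia.
(* Here 3k - 2i is split into the main term and a slack k - 2a, which is at least k / 2. *)
have le1 : 2 * (k + a - i) + (k - 2 * a) <= k * d - i.*2.
  have : k * 3 <= k * d by rewrite leq_mul2l d3 orbT.
  lia.
have le2 : 2 * (k' + b - i) + (k' - 2 * b) <= k' * d - i.*2.
  have : k' * 3 <= k' * d by rewrite leq_mul2l d3 orbT.
  have : i <= k' + b by have := leq_div2r 4 kk; rewrite -/a -/b; lia.
  lia.
apply: leq_trans (leq_sub2r _ (leq_mul le1 le2)).
(* The error is at most 5kd^2, hence at most kk' / 4 because k' >= n / 2 >= 20d^2; the product of
   the two slacks is at least kk' / 4. *)
have lepq : i.*2 * (d * d) + i.*2 * (d * d) <= (k - 2 * a) * (k' - 2 * b).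
  have h1 : k * k' <= 2 * (k - 2 * a) * (2 * (k' - 2 * b)) by apply: leq_mul; lia.
  have h2 : k * (20 * (d * d)) <= k * k' by rewrite leq_mul2l; apply/orP; right; lia.
  have h3 : 4 * i * (d * d) <= 5 * k * (d * d) by rewrite leq_mul2r; apply/orP; right; lia.
  lia.
have -> : 4 * ((k + a - i) * (k' + b - i)) = 2 * (k + a - i) * (2 * (k' + b - i)) by lia.
have aux P p Q q x : x <= p * q -> P * Q <= (P + p) * (Q + q) - x.
  by rewrite mulnDl !mulnDr; lia.
exact: aux.
Qed.

(** Each step gains the ratio 4(A - i)(B - i) / ((2i + 2)(2i + 1)), which is at least the ratio (A -
    i)(B - i) / (i + 1)^2 of consecutive products of binomials. *)
Lemma card_cut_graphs_growth d n (S : {set 'I_n}) i (k := #|S|) :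
  2 < d -> k.*2 <= n -> 40 * (d * d) <= n ->
  #|cut_graphs d S 0| * ('C(k + k %/ 4, i) * 'C(n - k + (n - k) %/ 4, i))
    <= #|cut_graphs d S i.*2|.
Proof.
move=> d3 kn nd; elim: i => [|i IH]; first by rewrite !bin0 !muln1.
set A := k + k %/ 4 in IH *; set B := n - k + (n - k) %/ 4 in IH *.
have [Ai|iA] := leqP A i; first by rewrite bin_small ?muln0.
have := card_cut_graphs_step d S i.*2; rewrite -/k => step.
have := switch_count_bound d3 kn nd iA; rewrite -/A -/B => le.
rewrite -(@leq_pmul2r (4 * (i.+1 * i.+1))) //.
have -> : #|cut_graphs d S 0| * ('C(A, i.+1) * 'C(B, i.+1)) * (4 * (i.+1 * i.+1)) =
  #|cut_graphs d S 0| * ((i.+1 * 'C(A, i.+1)) * (i.+1 * 'C(B, i.+1))) * 4 by lia.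
rewrite !mul_bin_left.
have -> : #|cut_graphs d S 0| * ((A - i) * 'C(A, i) * ((B - i) * 'C(B, i))) * 4 =
  #|cut_graphs d S 0| * ('C(A, i) * 'C(B, i)) * (4 * ((A - i) * (B - i))) by lia.
apply: leq_trans (leq_mul IH le) _; apply: leq_trans step _; rewrite doubleS.
by rewrite leq_mul2l; apply/orP; right; lia.
Qed.

Lemma leq_mul_bin a b c e : 'C(a, b) * 'C(c, e) <= 'C(a + c, b + e).
Proof.
rewrite -binomial.Vandermonde (bigD1 (inord b)) //= inordK ?ltnS ?leq_addr //.
by rewrite addKn leq_addr.
Qed.

(* Summing [card_cut_graphs_growth] over i with Vandermonde's identity. The factor
   'C(n, k) pays for the union bound over k-sets; the other one is the gain. *)
Lemma card_cut_graphs0 d n (S : {set 'I_n}) (k := #|S|) :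
  2 < d -> k.*2 <= n -> 40 * (d * d) <= n ->
  #|cut_graphs d S 0| * ('C(n, k) * 'C((n - k) %/ 4 + k %/ 4, k %/ 4))
    <= #|regular_graphs d n|.
Proof.
move=> d3 kn nd; have kn' : k <= n by lia.
set A := k + k %/ 4; set B := n - k + (n - k) %/ 4.
apply: (@leq_trans (#|cut_graphs d S 0| * 'C(B + A, A))).
  rewrite leq_mul2l; apply/orP; right.
  have -> : B + A = n + ((n - k) %/ 4 + k %/ 4) by rewrite /A /B; lia.
  exact: leq_mul_bin.
rewrite -binomial.Vandermonde big_distrr /=.
apply: (@leq_trans (\sum_(j < A.+1) #|cut_graphs d S j.*2|)).
  apply: leq_sum => j _; rewrite bin_sub -1?ltnS // [_ * 'C(A, _)]mulnC.
  exact: card_cut_graphs_growth.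
(* The cut sizes 2j are distinct, so the families being summed are disjoint. *)
under eq_bigr do rewrite -sum1_card.
rewrite (eq_bigr (fun j : 'I_A.+1 => \sum_(G in regular_graphs d n) (#|crossing G S| == j.*2))).
  rewrite exchange_big /= -sum1_card; apply: leq_sum => G _.
  have [j /eqP cj|none] := pickP [pred j : 'I_A.+1 | #|crossing G S| == j.*2].
    rewrite (bigD1 j) //= cj eqxx big1 // => i ij; case: eqP => // /double_inj e.
    by case/eqP: ij; apply: val_inj.
  by rewrite big1 // => j _; have := none j => /= ->.
by move=> j _; rewrite -big_mkcondr /=; apply: eq_bigl => G; rewrite inE.
Qed.

(** * Connectivity *)

Lemma card_exists_le (I T : finType) (X : {set T}) (P : pred I) (Q : T -> pred I) :
  #|[set t in X | [exists i, P i && Q t i]]| <= \sum_(i | P i) #|[set t in X | Q t i]|.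
Proof.
suff le : [set t in X | [exists i, P i && Q t i]] \subset
          \bigcup_(i | P i) [set t in X | Q t i].
  exact: leq_trans (subset_leq_card le) (card_bigcup_le _ _).
apply/subsetP=> t; rewrite inE => /andP[tX /existsP[i /andP[Pi Qi]]].
by apply/bigcupP; exists i; rewrite ?inE ?tX.
Qed.

(** A component and its complement both have no crossing arcs, and the smaller one is taken. It
    contains a vertex together with its d >= 3 neighbours. *)
Lemma closed_set_of_disconnected d n (G : {set {set 'I_n}}) :
  2 < d -> G \in regular_graphs d n -> ~~ connected_graph G ->
  exists S : {set 'I_n}, [/\ 3 < #|S|, #|S|.*2 <= n & #|crossing G S| = 0].
Proof.
move=> d3 Gr /forallPn[x /forallPn[y nxy]].
have [sG dG] := elimT (regular_graphsP _ _) Gr.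
pose S := component G x.
have cS : crossing G S = set0.
  apply/setP=> -[a b]; rewrite !inE /=; apply/negP=> /and3P[ab xa /negP]; apply.
  exact: connect_trans xa (connect1 ab).
have big (Z : {set 'I_n}) v : crossing G Z = set0 -> v \in Z -> 3 < #|Z|.
  move=> cZ vZ; apply: (@leq_ltn_trans d) => //.
  have sub : v |: neighbours G v \subset Z.
    rewrite subUset sub1set vZ; apply/subsetP=> w; rewrite inE => vw.
    apply/negPn/negP=> wZ; have : (v, w) \in crossing G Z by rewrite !inE /= vw vZ.
    by rewrite cZ inE.
  apply: leq_trans (subset_leq_card sub).
  rewrite cardsU1 card_neighbours // dG !inE (negbTE (_ : ~~ adjacent G v v)) //.
  by apply/negP=> /(adjacent_neq sG); rewrite eqxx.
have cS' : crossing G (~: S) = set0 by apply/eqP; rewrite -cards_eq0 crossingC cS cards0.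
have cn : #|S| + #|~: S| = n by rewrite cardsC card_ord.
have b1 : 3 < #|S| by apply: (big _ x) => //; rewrite inE.
have b2 : 3 < #|~: S| by apply: (big _ y) => //; rewrite !inE.
have [le|lt] := leqP #|S|.*2 n; first by exists S; rewrite cS cards0.
exists (~: S); rewrite cS' cards0; split=> //; lia.
Qed.

(** The union bound over k-sets costs exactly the factor 'C(n, k) of [card_cut_graphs0]. *)
Lemma card_closed_graphs d n k :
  2 < d -> k.*2 <= n -> 40 * (d * d) <= n ->
  #|[set G in regular_graphs d n |
      [exists S : {set 'I_n}, (#|S| == k) && (#|crossing G S| == 0)]]| *
    'C((n - k) %/ 4 + k %/ 4, k %/ 4) <= #|regular_graphs d n|.
Proof.
move=> d3 kn nd; set b := 'C(_, _).
have := card_exists_le (regular_graphs d n) [pred S : {set 'I_n} | #|S| == k]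
  (fun (G : {set {set 'I_n}}) => [pred S : {set 'I_n} | #|crossing G S| == 0]).
set X := [set G in _ | _]; rewrite -/X => le.
have C0 : 0 < 'C(n, k) by rewrite bin_gt0; lia.
rewrite -(leq_pmul2r C0) -mulnA [b * _]mulnC.
apply: leq_trans (leq_mul le (leqnn _)) _.
rewrite big_distrl /=.
apply: (@leq_trans (\sum_(S : {set 'I_n} | #|S| == k) #|regular_graphs d n|)).
  by apply: leq_sum => S /eqP kS; have := @card_cut_graphs0 d n S; rewrite kS; apply.
rewrite sum_nat_cond_const mulnC leq_mul2l; apply/orP; right.
rewrite -[X in 'C(X, _)](card_ord n) -cardsT -cards_draws.
by apply: subset_leq_card; apply/subsetP=> S; rewrite !inE subsetT.
Qed.

(** For 4 <= k < 8 the gain is linear in [n], but there are boundedly many such [k]; from k = 8 on,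
    [k %/ 4 >= 2] makes it quadratic, which pays for the sum over [k]. *)
Lemma card_disconnected d n :
  2 < d -> 40 * (d * d) <= n ->
  #|[set G in regular_graphs d n | ~~ connected_graph G]| * n
    <= 320 * #|regular_graphs d n|.
Proof.
move=> d3 nd; set N := #|regular_graphs d n|.
pose X k := #|[set G in regular_graphs d n |
      [exists S : {set 'I_n}, (#|S| == k) && (#|crossing G S| == 0)]]|.
have n0 : 0 < n by apply: leq_trans nd; rewrite muln_gt0 muln_gt0; lia.
have le : #|[set G in regular_graphs d n | ~~ connected_graph G]| <=
          \sum_(k < n.+1 | (3 < k) && (k.*2 <= n)) X k.
  apply: leq_trans (@card_exists_le 'I_n.+1 _ (regular_graphs d n)
    (fun k => (3 < k) && (k.*2 <= n)) (fun G k =>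
      [exists S : {set 'I_n}, (#|S| == k) && (#|crossing G S| == 0)])).
  apply: subset_leq_card; apply/subsetP=> G /setIdP[Gr /(closed_set_of_disconnected d3 Gr)].
  move=> [S [S3 Sn cS]]; rewrite inE Gr; apply/existsP; exists (inord #|S|).
  have Sn' : #|S| < n.+1 by lia.
  by rewrite inordK // S3 Sn; apply/existsP; exists S; rewrite eqxx cS.
rewrite -(leq_pmul2r n0); apply: leq_trans (leq_mul (leq_mul le (leqnn _)) (leqnn _)) _.
rewrite -mulnA big_distrl /=.
(* After multiplication by n^2, sizes below 8 give at most 8nN each and the others at most 128N
   each. The total is at most (64 + 256)nN, whence the constant 320. *)
apply: (@leq_trans (\sum_(k < n.+1) ((k < 8) * (8 * n * N) + 128 * N))).
  rewrite big_mkcond; apply: leq_sum => k _; case: ifP => // /andP[k3 kn].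
  have := card_closed_graphs d3 kn nd; rewrite -/(X k) -/N.
  set m := (n - k) %/ 4; have mn : n <= 8 * m.+1.
    have := divn_eq (n - k) 4; rewrite -/m; have := ltn_pmod (n - k) (isT : 0 < 4); lia.
  have [k8|k8] := ltnP k 8.
    have -> : k %/ 4 = 1.
      by have := leq_div2r 4 k3; have := leq_div2r 4 (k8 : k <= 7); rewrite /=; lia.
    rewrite bin1 addn1 => h; rewrite mul1n; apply: leq_trans (leq_addr _ _).
    have -> : 8 * n * N = N * 8 * n by lia.
    rewrite mulnA leq_mul2r; apply/orP; right; apply: leq_trans (leq_mul h (leqnn 8)).
    by rewrite -mulnA leq_mul2l mulnC mn orbT.
  move=> h; rewrite mul0n add0n mulnC.
  have t2 : 2 <= k %/ 4 by have := leq_div2r 4 k8.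
  have : (m.+1 * m.+1) <= 2 * 'C(m + k %/ 4, k %/ 4).
    have binD a b : 'C(a + b, b) = 'C(a + b, a).
      by rewrite -(bin_sub (leq_addr b a)) addKn.
    rewrite binD.
    have : 'C(m + 2, m) <= 'C(m + k %/ 4, m) by apply: leq_bin2l; rewrite leq_add2l.
    rewrite -binD => h2; apply: leq_trans (leq_mul (leqnn 2) h2).
    rewrite addn2 bin2 /= mul2n; have := odd_double_half (m.+2 * m.+1).
    have -> : odd (m.+2 * m.+1) = false by rewrite oddM /=; case: (odd m).
    by rewrite add0n => ->; rewrite leq_mul.
  move: h; set c := 'C(_, _) => h h2.
  have h3 : n * n <= 8 * m.+1 * (8 * m.+1) by apply: leq_mul.
  have h4 : X k * (n * n) <= X k * (128 * c) by rewrite leq_mul2l; apply/orP; right; lia.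
  have -> : n * n * X k = X k * (n * n) by lia.
  by apply: leq_trans h4 _; rewrite mulnCA leq_mul2l h orbT.
rewrite big_split /= sum_nat_const card_ord -big_distrl /=.
have : \sum_(i < n.+1) (i < 8) <= 8.
  have sumE m : \sum_(i < m) (i < 8) = minn m 8.
    by elim: m => [|m IH]; rewrite ?big_ord0 ?big_ord_recr //= IH; lia.
  by rewrite sumE geq_minr.
move: (\sum_(i < n.+1) (i < 8)) => c c8.
have : c * (8 * n * N) <= 8 * (8 * n * N) by rewrite leq_mul2r c8 orbT.
have : N <= n * N by rewrite leq_pmull.
lia.
Qed.

(** * Local sparsity *)

Lemma ffact_leq_exp n k : n ^_ k <= n ^ k.
Proof. by elim: k => // k IH; rewrite ffactnSr expnSr leq_mul // leq_subr. Qed.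

Lemma leq_bin_exp n k : 'C(n, k) <= n ^ k.
Proof.
by apply: leq_trans (ffact_leq_exp n k); rewrite -bin_ffact leq_pmulr ?fact_gt0.
Qed.

(* As 'C(2k, k) <= 4 ^ k and (2k)!/k! >= k ^ k, one has k ^ k <= 4 ^ k k!. *)
Lemma bin_mul_exp n k : 'C(n, k) * k ^ k <= 4 ^ k * n ^ k.
Proof.
have bin2n m j : 'C(m, j) <= 2 ^ m.
  elim: m j => [|m IH] [|j] //; first by rewrite bin0 expn_gt0.
  by rewrite binS expnS mul2n -addnn leq_add.
have ffact_ge m j : (m - j) ^ j <= m ^_ j.
  elim: j => // j IH; rewrite ffactnSr expnSr leq_mul ?leq_sub //.
  by apply: leq_trans IH; case: j => // j; rewrite leq_exp2r // leq_sub.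
have kk : k ^ k <= 4 ^ k * k`!.
  have := ffact_ge (k + k) k; rewrite addnK => le; apply: leq_trans le _.
  rewrite -bin_ffact leq_mul2r (leq_trans (bin2n _ _)) ?orbT //.
  by rewrite addnn -mul2n expnM.
apply: leq_trans (leq_mul (leqnn _) kk) _.
by rewrite mulnCA leq_mul2l bin_ffact ffact_leq_exp orbT.
Qed.

(** First moment: a k-set [S] spanning at least [t] edges contains all members of some t-set [F] of
    edges. Choose [S], then [F] among the pairs of [S], then a graph containing [F]. *)
Lemma sum_dense d n k t :
  2 * (2 * t + 2 * (d * d.+1)) <= d * n ->
  (\sum_(G in regular_graphs d n) #|[set S : {set 'I_n} | #|S| == k & t <= #|inner G S|]|)
    * n ^ t <= 'C(n, k) * ('C('C(k, 2), t) * ((2 * d) ^ t * #|regular_graphs d n|)).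
Proof.
move=> tn.
pose D (S : {set 'I_n}) := [set F : {set {set 'I_n}} | F \subset pairs S & #|F| == t].
have le : \sum_(G in regular_graphs d n) #|[set S : {set 'I_n} | #|S| == k & t <= #|inner G S|]|
    <= \sum_(S : {set 'I_n} | #|S| == k) \sum_(F in D S) #|supergraphs d F|.
  have supE F : #|supergraphs d F| = \sum_(G in regular_graphs d n) (F \subset G).
    by rewrite -sum1_card -big_mkcondr /=; apply: eq_bigl => G; rewrite inE.
  rewrite [leqRHS](eq_bigr (fun S => \sum_(G in regular_graphs d n)
      \sum_(F in D S) (F \subset G))); last first.
    by move=> S _; rewrite exchange_big /=; apply: eq_bigr => F _; rewrite supE.
  rewrite exchange_big /=; apply: leq_sum => G Gr.
  have [sG _] := elimT (regular_graphsP _ _) Gr.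
  rewrite -[leqLHS]sum1_card.
  rewrite [leqLHS](eq_bigl (fun S : {set 'I_n} => (#|S| == k) && (t <= #|inner G S|)));
    last first.
    by move=> S; rewrite inE.
  rewrite big_mkcondr /=; apply: leq_sum => S _; case: ifP => // tS.
  have : 0 < #|[set F : {set {set 'I_n}} | F \subset inner G S & #|F| == t]|.
    by rewrite cards_draws bin_gt0.
  rewrite card_gt0 => /set0Pn[F]; rewrite inE => /andP[FS Ft].
  have FD : F \in D S by rewrite inE Ft andbT (subset_trans FS) // inner_pairs.
  rewrite (bigD1 F) //= (_ : F \subset G) ?leq_addr //.
  by apply: subset_trans FS _; apply/subsetP=> e; rewrite inE => /andP[].
apply: leq_trans (leq_mul le (leqnn _)) _.
have -> : 'C(n, k) = #|[set S : {set 'I_n} | #|S| == k]|.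
  rewrite -[in LHS](card_ord n) -cardsT -cards_draws.
  by apply: eq_card => S; rewrite !inE subsetT.
rewrite -sum_nat_const big_distrl /=.
rewrite [leqRHS](eq_bigl (fun S : {set 'I_n} => #|S| == k)); last first.
  by move=> S; rewrite inE.
apply: leq_sum => S /eqP kS.
have -> : 'C('C(k, 2), t) = #|D S| by rewrite cards_draws card_pairs kS.
rewrite -sum_nat_const big_distrl; apply: leq_sum => F; rewrite inE => /andP[_ /eqP Ft].
by rewrite -Ft card_supergraphs_le // Ft.
Qed.

(** With t = k, the number of k-sets is at most n^k and cancels n^t, so the mean is bounded
    independently of [n]. *)
Lemma sum_dense_sets d n L :
  0 < n -> 2 * (2 * L + 2 * (d * d.+1)) <= d * n ->
  \sum_(G in regular_graphs d n) #|dense_sets G L| <=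
    (\sum_(k < L.+1) 'C('C(k, 2), k) * (2 * d) ^ k) * #|regular_graphs d n|.
Proof.
move=> n0 nL.
apply: (@leq_trans (\sum_(k < L.+1) \sum_(G in regular_graphs d n)
    #|[set S : {set 'I_n} | #|S| == k & k <= #|inner G S|]|)).
  rewrite exchange_big /=; apply: leq_sum => G _.
  have le : dense_sets G L \subset \bigcup_(k < L.+1)
      [set S : {set 'I_n} | #|S| == k & k <= #|inner G S|].
    apply/subsetP=> S; rewrite inE => /andP[SL SS]; apply/bigcupP.
    by exists (inord #|S|) => //; rewrite inE inordK // eqxx.
  by apply: leq_trans (subset_leq_card le) _; apply: card_bigcup_le.
rewrite big_distrl /=; apply: leq_sum => k _.
have nk : 0 < n ^ k by rewrite expn_gt0 n0.
rewrite -(leq_pmul2r nk); apply: leq_trans (sum_dense _ _) _.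
  by apply: leq_trans nL; have := ltn_ord k; lia.
by rewrite [leqRHS]mulnC leq_mul ?leq_bin_exp // mulnA.
Qed.

(** With t = k + s the first moment is at most 4^(k + t) (2d)^t (k / n)^s: each surplus edge yields
    a factor k / n. As k <= ps, the exponential factors are absorbed in K^s, and 4Kk <= n leaves
    4^(-s). *)
Lemma card_linear_dense d n p k (s := (k %/ p).+1) :
  1 < d -> 1 < p -> 1 < k -> 40 * (d * d) <= n -> 4 * (256 * (d * d)) ^ p * k <= n ->
  #|[set G in regular_graphs d n |
      [exists S : {set 'I_n}, (#|S| == k) && (k + s <= #|inner G S|)]]| * 4 ^ s
    <= #|regular_graphs d n|.
Proof.
move=> d1 p1 k1 nd nk; set X := #|_|; set N := #|_|.
pose t := k + s; set M := 256 * (d * d) in nk *; pose K := M ^ p.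
have sk : s <= k.
  rewrite /s; have : k %/ p <= k %/ 2 by apply: leq_div2l.
  have := leq_trunc_div k 2; lia.
have M0 : 0 < M by rewrite /M; nia.
have kps : k <= p * s by rewrite /s mulnC ltnW // ltn_ceil //; lia.
have leX : X * n ^ t <= 'C(n, k) * ('C('C(k, 2), t) * ((2 * d) ^ t * N)).
  apply: leq_trans (sum_dense _ _); last first.
    have MK : M <= K by rewrite /K -[leqLHS]expn1 leq_exp2l; rewrite /M; nia.
    have h1 : 4 * 256 * k <= n.
      apply: leq_trans nk; rewrite -/K leq_mul2r; apply/orP; right.
      have : 256 <= M by rewrite /M; nia.
      by lia.
    have : 2 * n <= d * n by rewrite leq_mul2r d1 orbT.
    by rewrite /t; nia.
  rewrite leq_mul2r; apply/orP; right.
  rewrite /X -sum1_card (eq_bigl (fun G : {set {set 'I_n}} => (G \in regular_graphs d n) &&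
      [exists S : {set 'I_n}, (#|S| == k) && (k + s <= #|inner G S|)])); last first.
    by move=> G; rewrite inE.
  rewrite big_mkcondr /=; apply: leq_sum => G _; case: ifP => // /existsP[S kS].
  by rewrite card_gt0; apply/set0Pn; exists S; rewrite inE.
have n0 : 0 < n by nia.
have k0 : 0 < k by lia.
(* Both sides carry the factor n^k k^k k^t, which lets [bin_mul_exp] be used without division; it is
   cancelled afterwards. *)
have le1 : X * n ^ s * (n ^ k * (k ^ k * k ^ t)) <= (K * k) ^ s * N * (n ^ k * (k ^ k * k ^ t)).
  apply: (@leq_trans (X * n ^ t * (k ^ k * t ^ t))).
    have -> : X * n ^ s * (n ^ k * (k ^ k * k ^ t)) = X * n ^ t * (k ^ k * k ^ t).
      by rewrite [n ^ t]expnD; lia.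
    rewrite leq_mul2l; apply/orP; right; rewrite leq_mul2l; apply/orP; right.
    by rewrite leq_exp2r ?leq_addr //; lia.
  apply: leq_trans (leq_mul leX (leqnn _)) _.
  have b1 := bin_mul_exp n k; have b2 := bin_mul_exp 'C(k, 2) t.
  have b3 : 'C(k, 2) ^ t <= k ^ (2 * t).
    by rewrite expnM leq_exp2r ?leq_bin_exp //; rewrite /t; lia.
  (* Since t <= 2k, the left side is at most (4(8d)^2)^k = M^k; this explains the constant 256. *)
  have b4 : 4 ^ k * 4 ^ t * (2 * d) ^ t <= K ^ s.
    rewrite /K -expnM; apply: (@leq_trans (M ^ k)); last by rewrite leq_pexp2l.
    rewrite /M (_ : 256 * (d * d) = 4 * (4 * (2 * d)) * (4 * (2 * d))); last by lia.
    rewrite 2![in leqRHS]expnMn -!mulnA leq_mul2l; apply/orP; right.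
    rewrite -[leqLHS]expnMn -[leqRHS]expnD; apply: leq_pexp2l; first by nia.
    by rewrite /t; lia.
  apply: (@leq_trans (4 ^ k * n ^ k * (4 ^ t * k ^ (2 * t) * ((2 * d) ^ t * N)))).
    have -> : 'C(n, k) * ('C('C(k, 2), t) * ((2 * d) ^ t * N)) * (k ^ k * t ^ t) =
       'C(n, k) * k ^ k * ('C('C(k, 2), t) * t ^ t * ((2 * d) ^ t * N)) by lia.
    apply: leq_mul => //; apply: leq_mul => //; apply: leq_trans b2 _.
    by rewrite leq_mul2l b3 orbT.
  have -> : k ^ (2 * t) = k ^ s * (k ^ k * k ^ t).
    by rewrite -!expnD; congr (_ ^ _); rewrite /t; lia.
  rewrite [(K * k) ^ s]expnMn.
  have -> : 4 ^ k * n ^ k * (4 ^ t * (k ^ s * (k ^ k * k ^ t)) * ((2 * d) ^ t * N)) =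
    4 ^ k * 4 ^ t * (2 * d) ^ t * (k ^ s * N * (n ^ k * (k ^ k * k ^ t))) by lia.
  have -> : K ^ s * k ^ s * N * (n ^ k * (k ^ k * k ^ t)) =
    K ^ s * (k ^ s * N * (n ^ k * (k ^ k * k ^ t))) by lia.
  by rewrite leq_mul2r b4 orbT.
rewrite leq_pmul2r in le1; last by rewrite !muln_gt0 !expn_gt0 n0 k0.
have Kk0 : 0 < (K * k) ^ s by rewrite expn_gt0 muln_gt0 k0 /K expn_gt0 M0.
rewrite -(leq_pmul2l Kk0); apply: leq_trans le1.
rewrite mulnCA leq_mul2l -expnMn leq_exp2r // mulnC mulnA.
by rewrite -/K in nk; rewrite nk orbT.
Qed.

(** The surplus [s] is at least n / (cp) and 4^s >= s^2, so each size has probability at most (cp /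
    n)^2; there are at most n + 1 <= 2n sizes. *)
Lemma card_linear_dense_sum d n p c (K := (256 * (d * d)) ^ p) :
  1 < d -> 1 < p -> 0 < c -> 40 * (d * d) <= n -> 2 * c <= n ->
  #|[set G in regular_graphs d n | [exists S : {set 'I_n},
      [&& n <= c * #|S|, 4 * K * #|S| <= n & #|S| + (#|S| %/ p).+1 <= #|inner G S|]]]| * n
    <= 2 * (c * p) ^ 2 * #|regular_graphs d n|.
Proof.
move=> d1 p1 c0 nd nc; set N := #|regular_graphs d n|.
have n0 : 0 < n by nia.
pose X k := #|[set G in regular_graphs d n |
      [exists S : {set 'I_n}, (#|S| == k) && (k + (k %/ p).+1 <= #|inner G S|)]]|.
set Y := #|_|.
have le : Y <= \sum_(k < n.+1 | (n <= c * k) && (4 * K * k <= n)) X k.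
  apply: leq_trans (@card_exists_le 'I_n.+1 _ (regular_graphs d n)
    (fun k => (n <= c * k) && (4 * K * k <= n)) (fun G k =>
      [exists S : {set 'I_n}, (#|S| == k) && (k + (k %/ p).+1 <= #|inner G S|)])).
  apply: subset_leq_card; apply/subsetP=> G /setIdP[Gr /existsP[S /and3P[S1 S2 S3]]].
  rewrite inE Gr; apply/existsP; exists (inord #|S|).
  have Sn : #|S| < n.+1 by rewrite ltnS -[X in _ <= X](card_ord n) max_card.
  by rewrite inordK // S1 S2; apply/existsP; exists S; rewrite eqxx.
rewrite -(leq_pmul2r n0) -mulnA; apply: leq_trans (leq_mul le (leqnn _)) _.
rewrite big_distrl /=; apply: (@leq_trans (\sum_(k < n.+1) (c * p) ^ 2 * N)).
  rewrite big_mkcond; apply: leq_sum => k _; case: ifP => // /andP[nk Kk].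
  have k1 : 1 < k by rewrite -(ltn_pmul2l c0); nia.
  have := card_linear_dense d1 p1 k1 nd Kk; rewrite -/(X k) -/N.
  set s := (k %/ p).+1 => h.
  have kps : k <= p * s by rewrite /s mulnC ltnW // ltn_ceil //; lia.
  have s4 : s * s <= 4 ^ s.
    by rewrite (_ : 4 = 2 * 2) // expnMn leq_mul // ltnW // ltn_expl.
  have ncps : n <= c * p * s by rewrite -mulnA (leq_trans nk) // leq_mul2l kps orbT.
  apply: (@leq_trans (X k * ((c * p) ^ 2 * 4 ^ s))).
    rewrite leq_mul2l; apply/orP; right; apply: leq_trans (leq_mul ncps ncps) _.
    rewrite mulnACA mulnn leq_mul2l s4 orbT //.
  by rewrite mulnCA leq_mul2l h orbT.
rewrite sum_nat_const card_ord.
have : n.+1 <= 2 * n by lia.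
move=> h; apply: leq_trans (leq_mul h (leqnn _)) _.
by rewrite leq_eqVlt; apply/orP; left; apply/eqP; lia.
Qed.

(** * Existence of regular graphs *)

(* A circulant graph: join x and y when y - x lies in a symmetric set of d nonzero
   residues. *)
Lemma regular_graphs_nonempty d n :
  d < n -> ~~ odd (d * n) -> 0 < #|regular_graphs d n|.
Proof.
case: n => // n dn dn2.
have [D [D0 DN cD]] : exists D : {set 'I_n.+1},
    [/\ 0%R \notin D, forall z, (z \in D) -> ((- z)%R \in D) & #|D| = d].
  (* [P] consists of the residues 1, ..., h and [Q] of their negatives. For odd [d] the number
     [n.+1] of vertices is even, and [C] adds its half, which is its own negative. *)
  pose h := d./2; pose P : {set 'I_n.+1} := [set inord k.+1 | k : 'I_h].
  have dh := odd_double_half d; rewrite -/h in dh.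
  have Pval z : z \in P -> 0 < z <= h.
    by case/imsetP=> k _ ->; rewrite inordK; have := ltn_ord k; lia.
  have Nval (z : 'I_n.+1) : 0 < z -> (- z)%R = n.+1 - z :> nat.
    by move=> z0; rewrite /= modn_small //; have := ltn_ord z; lia.
  have cP : #|P| = h.
    rewrite card_imset ?card_ord // => i j e; apply: val_inj.
    have := congr1 val e; rewrite /= !inordK; have := ltn_ord i; have := ltn_ord j; lia.
  pose Q : {set 'I_n.+1} := [set (- z)%R | z in P].
  have cQ : #|Q| = h by rewrite card_imset ?cP //; apply: GRing.oppr_inj.
  have Qval z : z \in Q -> n.+1 - h <= z.
    by case/imsetP=> w /Pval /andP[w0 wh] ->; rewrite Nval //; lia.
  have PQ : [disjoint P & Q].
    apply/pred0P=> z /=; apply/negP=> /andP[/Pval /andP[_ zh] /Qval]; lia.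
  pose c : 'I_n.+1 := inord n.+1./2.
  pose C : {set 'I_n.+1} := if odd d then [set c] else set0.
  have Cval z : z \in C -> odd d /\ z = n.+1./2 :> nat.
    rewrite /C; case: ifP; last by rewrite inE.
    move=> od; rewrite inE => /eqP ->; split=> //; rewrite /c inordK //.
    by have := odd_double_half n.+1; lia.
  have n2 : odd d -> n.+1 = (n.+1./2).*2.
    move=> od; move: dn2; rewrite oddM od /= negbK => on.
    by have := odd_double_half n.+1; rewrite /= on; lia.
  exists (P :|: Q :|: C); split.
  - rewrite !inE !negb_or -andbA; apply/and3P; split; apply/negP.
    + by move/Pval.
    + by move/Qval => /=; lia.
    + by move/Cval=> -[od e]; have := n2 od; move: e => /=; lia.
  - move=> z; rewrite !inE => /orP[/orP[zP|zQ]|zC].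
    + by rewrite [(- z)%R \in Q]imset_f ?orbT.
    + by case/imsetP: zQ => w wP ->; rewrite GRing.opprK wP.
    + suff -> : (- z)%R = z by rewrite zC orbT.
      have [od e] := Cval z zC; have e2 := n2 od.
      by apply: ord_inj; rewrite Nval; lia.
  - have cC : #|C| = odd d by rewrite /C; case: odd; rewrite ?cards1 ?cards0.
    have PQC : (P :|: Q) :&: C = set0.
      apply/setP=> z; rewrite !inE; apply/negP=> /andP[zPQ /Cval[od e]].
      have e2 := n2 od; rewrite od /= in dh.
      by case/orP: zPQ => [/Pval|/Qval]; lia.
    rewrite cardsU PQC cards0 subn0 cardsU cP cQ cC.
    by rewrite (disjoint_setI0 PQ) cards0; lia.
pose G : {set {set 'I_n.+1}} :=
  [set e | [exists x, exists y, (e == [set x; y]) && ((y - x)%R \in D)]].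
have adjE x y : adjacent G x y = ((y - x)%R \in D).
  rewrite /adjacent inE; apply/existsP/idP=> [[u /existsP[v /andP[/eqP e uv]]]|xy].
    by case/set2_inj: e => -[-> ->] //; rewrite -GRing.opprB DN.
  by exists x; apply/existsP; exists y; rewrite eqxx.
have sG : simple_graph G.
  apply/forallP=> e; apply/implyP; rewrite inE => /existsP[x /existsP[y /andP[/eqP -> xy]]].
  by rewrite cards2; case: (eqVneq x y) xy => // ->; rewrite GRing.subrr (negbTE D0).
rewrite card_gt0; apply/set0Pn; exists G; apply/regular_graphsP; split=> // v.
rewrite -card_neighbours // -cD -(card_imset D (@GRing.addrI _ v)).
apply: eq_card => w; rewrite inE adjE; apply/idP/imsetP=> [vw|[z zD ->]].
  by exists (w - v)%R => //; rewrite GRing.addrC GRing.subrK.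
by rewrite GRing.addrC GRing.addKr.
Qed.

(** * Colourings *)

Definition color_class n (G : {set {set 'I_n}}) r (f : coloring G r) (i : 'I_r) :
    {set {set 'I_n}} :=
  [set val e | e in [set e | f e == i]].

Lemma color_class_sub n (G : {set {set 'I_n}}) r (f : coloring G r) i :
  color_class f i \subset G.
Proof. by apply/subsetP=> _ /imsetP[e _ ->]; apply: valP. Qed.

Lemma color_countE n (G : {set {set 'I_n}}) r (f : coloring G r) T i :
  color_count f T i = #|color_class f i :&: T|.
Proof.
rewrite /color_count -(card_imset _ val_inj); apply: eq_card => e.
apply/imsetP/idP.
  by move=> [x]; rewrite !inE => /andP[fx xT] ->; rewrite xT imset_f ?inE.
by rewrite !inE => /andP[/imsetP[x]]; rewrite inE => fx -> xT; exists x; rewrite // inE fx.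
Qed.

Lemma sum_card_color_class n (G : {set {set 'I_n}}) r (f : coloring G r) :
  \sum_(i < r) #|color_class f i| = #|G|.
Proof.
rewrite -[RHS](card_sig (mem G)) -sum1_card (partition_big f predT) //=.
apply: eq_bigr => i _; rewrite (card_imset _ val_inj) -sum1_card.
by apply: eq_bigl => e; rewrite inE.
Qed.

Lemma large_color_class n (G : {set {set 'I_n}}) r (f : coloring G r) m :
  r * m < #|G| -> exists i : 'I_r, m < #|color_class f i|.
Proof.
move=> lt; apply/existsP; apply: contraTT lt; rewrite negb_exists -leqNgt => /forallP h.
rewrite -(sum_card_color_class f) -[X in X * m](card_ord r) -sum_nat_const.
by apply: leq_sum => i _; rewrite leqNgt.
Qed.

(** Edges are coloured by their rank modulo the number of colours. Inside a class the quotient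
    determines the edge, so a class has at most |G| / r + 1 edges. *)
Lemma balanced_coloring n (G : {set {set 'I_n}}) r :
  0 < r -> exists f : coloring G r, forall T i, r * color_count f T i <= #|G| + r.
Proof.
case: r => // r _.
pose f : coloring G r.+1 := [ffun e => inord (enum_rank e %% r.+1)].
exists f => T i; apply: (@leq_trans (r.+1 * (#|G| %/ r.+1).+1)); last first.
  by rewrite mulnS addnC leq_add2r mulnC leq_trunc_div.
rewrite leq_mul2l /= color_countE (leq_trans (subset_leq_card (subsetIl _ _))) //.
rewrite (card_imset _ val_inj).
have lt (e : {e : {set 'I_n} | e \in G}) : enum_rank e %/ r.+1 < (#|G| %/ r.+1).+1.
  rewrite ltnS leq_div2r //; apply: leq_trans (ltnW (ltn_ord _)) _.
  by rewrite card_sig.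
rewrite -[leqRHS]card_ord.
rewrite -(card_in_imset (f := fun e : {e : {set 'I_n} | e \in G} => Ordinal (lt e))) ?max_card //.
move=> e e'; rewrite !inE !ffunE => /eqP ei /eqP ei' [] eq_div.
apply: enum_rank_inj; apply: ord_inj.
rewrite (divn_eq (enum_rank e) r.+1) (divn_eq (enum_rank e') r.+1) eq_div; congr (_ + _).
by have := congr1 val (etrans ei (esym ei')); rewrite /= !inordK ?ltn_pmod.
Qed.

(** * The deterministic argument on good graphs *)

Lemma subset_card_exists (T : finType) (A : {set T}) m :
  m <= #|A| -> exists2 B : {set T}, B \subset A & #|B| = m.
Proof.
rewrite -bin_gt0 -cards_draws card_gt0 => /set0Pn[B].
by rewrite inE => /andP[BA /eqP Bm]; exists B.
Qed.

(* The sets counted by [dense_sets G p] have at most p vertices and span a cycle,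
   except for the empty set, which is also counted. *)
Definition good_graph n (G : {set {set 'I_n}}) (p c K w : nat) : bool :=
  [&& connected_graph G,
      [forall S : {set 'I_n}, (n <= c * #|S|) ==> (4 * K * #|S| <= n) ==>
         (#|inner G S| < #|S| + (#|S| %/ p).+1)] &
      #|dense_sets G p| * w <= n].

(** [forest_excess] is applied to a maximal forest of [F], extended to [T]. One half of 4|F| comes
    from its large components, the other from the sparsity surplus 2|F| / p. *)
Lemma good_graph_forest d n (G F : {set {set 'I_n}}) (p c K w : nat) :
  G \in regular_graphs d n -> 0 < p -> 0 < c -> good_graph G p c K w ->
  F \subset G -> 8 * K * #|F| <= n ->
  exists2 T : {set {set 'I_n}}, spanning_tree G T &
    p * #|F| <= p * #|F :&: T| + 4 * #|F| + p * ((d * n) %/ c) +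
       p ^ 3 * #|dense_sets G p|.
Proof.
move=> Gr p0 c0 /and3P[cG /forallP sparse _] FG Fn; have [sG dG] := elimT (regular_graphsP _ _) Gr.
have [A [_ AF acA FA]] := maximal_forest (sub0set F) (acyclic_set0 n).
have [T AT sT] := spanning_tree_extend cG (subset_trans AF FG) acA.
exists T => //.
(* Sets with at least n / c vertices have surplus at most 2|F| / p by sparsity; smaller ones span at
   most dn / c edges by regularity alone. *)
pose z := (2 * #|F|) %/ p + (d * n) %/ c.
have spz (B : {set 'I_n}) : #|B| <= 2 * #|F| -> #|inner G B| <= #|B| + z.
  move=> BF; have [nB|Bn] := leqP n (c * #|B|).
    move/(_ B): sparse; rewrite nB /= => /implyP h.
    have {}h : #|inner G B| < #|B| + (#|B| %/ p).+1.
      by apply: h; apply: leq_trans Fn; apply: leq_trans (leq_mul (leqnn (4 * K)) BF) _;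
        rewrite mulnA leq_mul2r; apply/orP; right; lia.
    rewrite addnS ltnS in h; apply: leq_trans h _.
    by rewrite leq_add2l (leq_trans (leq_div2r p BF)) // leq_addr.
  have le : #|inner G B| <= #|B| * d.
    have : 2 * #|inner G B| <= #|B| * d.
      rewrite -card_arcs_simple; last first.
        by apply: simple_graphS sG; apply/subsetP=> e; rewrite inE => /andP[].
      rewrite -(card_arcs_from B Gr); apply: subset_leq_card; apply/subsetP=> a.
      by rewrite !inE /adjacent inE subUset !sub1set => /and3P[-> ->].
    by apply: leq_trans; rewrite leq_pmull.
  have : #|B| * d <= (d * n) %/ c.
    by rewrite leq_divRL // mulnC mulnA mulnC leq_mul2l ltnW ?orbT.
  by move=> h; rewrite (leq_trans le) // (leq_trans h) // /z addnA leq_addl.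
have AFT : #|A| <= #|F :&: T| by apply: subset_leq_card; rewrite subsetI AF.
have pz : p * z <= 2 * #|F| + p * ((d * n) %/ c).
  by rewrite /z mulnDr leq_add2r mulnC leq_trunc_div.
move: z spz pz => z spz pz; have := forest_excess sG FG AF p0 FA spz.
have : p * #|A| <= p * #|F :&: T| by rewrite leq_mul2l AFT orbT.
rewrite !mulnDr mulnA -expnS => leA le; apply: leq_trans le _.
rewrite (_ : 4 * #|F| = 2 * #|F| + 2 * #|F|); last by rewrite -mulnDl.
have aux x1 x2 x3 y1 y2 u : x1 <= y1 -> x2 <= u + y2 ->
    x1 + x2 + x3 + u <= y1 + (u + u) + y2 + x3 by lia.
exact: aux.
Qed.

(** The values of [p], [c] and [w] make each of the three error terms of [good_graph_forest] cost at
    most a third of the allowed [n]; see [t1], [t2] and [t3]. *)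
Lemma good_graph_coloring d n r E (p := 24 * E * d) (c := 6 * r * E * d)
    (K := (256 * (d * d)) ^ p) (w := 6 * r * E * p ^ 2) (G : {set {set 'I_n}})
    (f : coloring G r) :
  0 < d -> 0 < E -> 8 * K * d <= r -> 2 * r <= n ->
  G \in regular_graphs d n -> good_graph G p c K w ->
  exists T i, spanning_tree G T /\ E * d * n <= 2 * E * r * color_count f T i + n.
Proof.
move=> d0 E0 Kr rn Gr gG; have hG := card_regular_graph Gr.
have p0 : 0 < p by rewrite /p; nia.
have K0 : 0 < K by rewrite /K expn_gt0; nia.
have r0 : 0 < r by nia.
have c0 : 0 < c by rewrite /c; nia.
(* This is dn / 2r rounded up, and the pigeonhole principle applies to m - 1. Cutting a colour class
   down to exactly [m] edges keeps 8K|F| <= n. *)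
pose m := (d * n + 2 * r - 1) %/ (2 * r).
have r2 : 0 < 2 * r by lia.
have m1 : d * n <= 2 * r * m.
  have := divn_eq (d * n + 2 * r - 1) (2 * r); have := ltn_pmod (d * n + 2 * r - 1) r2.
  rewrite -/m; lia.
have m2 : 2 * r * m <= 2 * d * n.
  have := leq_trunc_div (d * n + 2 * r - 1) (2 * r); rewrite -/m.
  have : n <= d * n by rewrite leq_pmull.
  lia.
have n0 : 0 < n by lia.
have m0 : 0 < m by rewrite lt0n; apply: contraTneq m1 => ->; rewrite muln0 -ltnNge muln_gt0 d0.
have [i mi] : exists i, m.-1 < #|color_class f i|.
  apply: large_color_class.
  have := leq_trunc_div (d * n + 2 * r - 1) (2 * r); rewrite -/m.
  have : r * m = r * m.-1 + r by rewrite -{1}(prednK m0) mulnS addnC.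
  have : m * (2 * r) = 2 * (r * m) by lia.
  lia.
rewrite prednK // in mi; have [F Fi Fm] := subset_card_exists mi.
have FG := subset_trans Fi (color_class_sub f i).
have KF : 8 * K * #|F| <= n.
  rewrite Fm -(leq_pmul2l r0).
  have : 8 * K * (r * m) <= 8 * K * (d * n) by rewrite leq_mul2l; apply/orP; right; lia.
  have : 8 * K * d * n <= r * n by rewrite leq_mul2r Kr orbT.
  lia.
have [T sT le] := good_graph_forest Gr p0 c0 gG FG KF.
exists T, i; split=> //.
have cT : #|F :&: T| <= color_count f T i.
  by rewrite color_countE; apply: subset_leq_card; apply: setSI.
have {gG} dw : #|dense_sets G p| * w <= n by case/and3P: gG.
rewrite Fm in le; set a := #|F :&: T| in le cT; set b := #|dense_sets G p| in le dw.
set q := (d * n) %/ c in le.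
have cq : q * c <= d * n by apply: leq_trunc_div.
have t1 : 3 * (2 * r * E * (4 * m)) <= p * n.
  have : E * (2 * r * m) <= E * (2 * d * n) by rewrite leq_mul2l m2 orbT.
  rewrite /p; lia.
have t2 : 3 * (2 * r * E * (p * q)) <= p * n.
  have : 6 * r * E * q <= n.
    rewrite -(leq_pmul2l d0); move: cq; rewrite /c; lia.
  move=> h; have : p * (6 * r * E * q) <= p * n by rewrite leq_mul2l h orbT.
  lia.
have t3 : 3 * (2 * r * E * (p ^ 3 * b)) <= p * n.
  have : p * (b * w) <= p * n by rewrite leq_mul2l dw orbT.
  rewrite /w (expnS p 2); lia.
have le2 : 2 * r * E * (p * m) <= 2 * r * E * (p * a + 4 * m + p * q + p ^ 3 * b).
  by rewrite leq_mul2l le orbT.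
rewrite -(leq_pmul2l p0).
have : p * E * (d * n) <= p * E * (2 * r * m) by rewrite leq_mul2l m1 orbT.
have : p * (2 * E * r) * a <= p * (2 * E * r) * color_count f T i by rewrite leq_mul2l cT orbT.
rewrite !mulnDr in le2; rewrite !mulnDr; lia.
Qed.

(** Union bound over the three ways to fail; the third is Markov's inequality for the number of
    dense sets. *)
Lemma card_not_good_graph d n p c (K := (256 * (d * d)) ^ p) w :
  2 < d -> 1 < p -> 0 < c -> 40 * (d * d) <= n -> 2 * c <= n -> 4 * p <= n ->
  #|[set G in regular_graphs d n | ~~ good_graph G p c K w]| * n <=
    (320 + 2 * (c * p) ^ 2 + w * \sum_(k < p.+1) 'C('C(k, 2), k) * (2 * d) ^ k)
    * #|regular_graphs d n|.
Proof.
move=> d3 p1 c0 nd nc np; have n0 : 0 < n by lia.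
have d1 : 1 < d by lia.
pose B1 := [set G in regular_graphs d n | ~~ connected_graph G].
pose B2 := [set G in regular_graphs d n | [exists S : {set 'I_n},
      [&& n <= c * #|S|, 4 * K * #|S| <= n & #|S| + (#|S| %/ p).+1 <= #|inner G S|]]].
pose B3 := [set G in regular_graphs d n | n < #|dense_sets G p| * w].
have le : [set G in regular_graphs d n | ~~ good_graph G p c K w] \subset B1 :|: B2 :|: B3.
  apply/subsetP=> G; rewrite inE => /andP[Gr];
  rewrite !in_setU [_ \in B1]inE [_ \in B2]inE [_ \in B3]inE.
  rewrite Gr /= /good_graph !negb_and -ltnNge orbA => /orP[/orP[->//|]|->]; last by rewrite orbT.
  move=> /forallPn[S]; rewrite !negb_imply -leqNgt => S123.
  by apply/orP; left; apply/orP; right; apply/existsP; exists S.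
have b1 : #|B1| * n <= 320 * #|regular_graphs d n| by exact: (card_disconnected d3 nd).
have b2 : #|B2| * n <= 2 * (c * p) ^ 2 * #|regular_graphs d n|.
  exact: (card_linear_dense_sum d1 p1 c0 nd nc).
have b3 : #|B3| * n <= w * (\sum_(k < p.+1) 'C('C(k, 2), k) * (2 * d) ^ k) * #|regular_graphs d n|.
  have := @sum_dense_sets d n p n0 _; set s := \sum_(k < _) _ => h.
  apply: (@leq_trans (w * \sum_(G in regular_graphs d n) #|dense_sets G p|)); last first.
    rewrite -mulnA leq_mul2l h ?orbT //.
    have : 4 * (d * d.+1) <= n by nia.
    have : 2 * n <= d * n by rewrite leq_mul2r d1 orbT.
    nia.
  rewrite -sum_nat_const big_distrr /=.
  rewrite [leqRHS](bigID (fun G : {set {set 'I_n}} => n < #|dense_sets G p| * w)) /=.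
  apply: leq_trans (leq_addr _ _); rewrite (eq_bigl (fun G : {set {set 'I_n}} =>
     (G \in regular_graphs d n) && (n < #|dense_sets G p| * w))); last by move=> G; rewrite inE.
  by apply: leq_sum => G /andP[_ /ltnW]; rewrite mulnC.
rewrite 2![in leqRHS]mulnDl; apply: leq_trans (leq_add (leq_add b1 b2) b3).
rewrite -!mulnDl leq_mul2r; apply/orP; right.
apply: leq_trans (subset_leq_card le) _.
by rewrite (leq_trans (leq_card_setU _ _)) // leq_add2r leq_card_setU.
Qed.

(** * Probability *)

From mathcomp Require Import all_classical all_reals all_analysis.

Import Order.TTheory GRing.Theory Num.Theory.
Import numFieldNormedType.Exports.

Local Open Scope ring_scope.

Lemma whp_of_rare_failure (R : realType) (d : nat)
    (A : forall n : nat, pred {set {set 'I_n}}) (n0 C : nat) :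
  (forall n, (n0 <= n)%N -> ~~ odd (d * n) ->
     (#|[set G in regular_graphs d n | ~~ A n G]| * n <= C * #|regular_graphs d n|)%N) ->
  whp R d A.
Proof.
move=> rare; apply/cvgrPdist_le => e e0.
have [N NP] : exists N : nat, C%:R / e <= N%:R.
  exists (Num.bound (C%:R / e)); apply/ltW; apply: le_lt_trans (archi_boundP _); first exact: lexx.
  by rewrite divr_ge0 // ltW.
(* Beyond d + 1 vertices regular graphs exist, so the quotient is not 0 / 0; beyond [N] the failure
   probability C / n is at most [e]. *)
exists (maxn (maxn n0 d.+1) N.+1) => // n /= nN even.
move: nN; rewrite !geq_max => /andP[/andP[n0n dn] Nn].
have N0 := regular_graphs_nonempty dn even.
have := rare n n0n even.
have := cardsID [set G | A n G] (regular_graphs d n).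
have -> : #|regular_graphs d n :&: [set G | A n G]%SET| = #|[set G in regular_graphs d n | A n G]|.
  by apply: eq_card => G; rewrite !inE.
have -> : #|regular_graphs d n :\: [set G | A n G]%SET| =
    #|[set G in regular_graphs d n | ~~ A n G]|.
  by apply: eq_card => G; rewrite !inE andbC.
rewrite /regular_prob; set a := #|_|; set b := #|_|; set r := #|_| in N0 * => abr bn.
have r0 : 0 < r%:R :> R by rewrite ltr0n.
have n0' : 0 < n%:R :> R by rewrite ltr0n; lia.
have -> : 1 - a%:R / r%:R = b%:R / r%:R :> R.
  by rewrite -abr natrD; field; rewrite -natrD abr gt_eqF.
rewrite ger0_norm ?divr_ge0 // ler_pdivrMr //.
rewrite -(ler_pM2r n0') -natrM (le_trans (_ : _ <= (C * r)%:R)) ?ler_nat //.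
rewrite natrM mulrAC ler_pM2r // -ler_pdivrMl // mulrC (le_trans NP) // ler_nat; lia.
Qed.

(** * From colour counts to discrepancy *)

(** The discrepancy of a tree is [r] times its largest colour count, minus n - 1; replacing n - 1 by
    [n] only lowers it. *)
Lemma discrepancy_lower (R : realType) (d n r : nat) (e : R) (G : {set {set 'I_n}}) :
  (0 < r)%N ->
  [forall f : coloring G r, exists T : {set {set 'I_n}},
         spanning_tree G T &&
         [exists i : 'I_r, (d%:R / (2 * r%:R) - e / r%:R) * n%:R
                             <= (color_count f T i)%:R :> R]] ->
  (((d%:R / 2 - 1 - e) * n%:R)%:E <= spanning_tree_discrepancy R r G)%E.
Proof.
move=> r0 /forallP h.
apply/bigmin_geP; split; first by rewrite leey.
move=> f _; have /existsP[T /andP[sT /existsP[i le]]] := h f.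
apply: le_trans (le_bigmax_cond _ _ sT); rewrite lee_fin /tree_discrepancy.
have r0' : 0 < r%:R :> R by rewrite ltr0n.
have {}le : (d%:R / (2 * r%:R) - e / r%:R) * n%:R <= (\max_(i < r) color_count f T i)%N%:R :> R.
  by apply: le_trans le _; rewrite ler_nat; apply: (leq_bigmax i).
rewrite -(ler_pM2l r0') in le.
rewrite mulrBr mulrCA divff ?gt_eqF // mulr1.
have -> : (d%:R / 2 - 1 - e) * n%:R =
  r%:R * ((d%:R / (2 * r%:R) - e / r%:R) * n%:R) - n%:R :> R.
  by field; rewrite gt_eqF.
lra.
Qed.

(** Here the 1 in n - 1 counts against the bound: it is absorbed in a second term [e * n], whence
    the factor 2. *)
Lemma discrepancy_upper (R : realType) (d n r : nat) (e : R) (G : {set {set 'I_n}}) :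
  (0 < r)%N -> 1 <= e * n%:R ->
  [exists f : coloring G r, forall T : {set {set 'I_n}},
         spanning_tree G T ==>
         [forall i : 'I_r, (color_count f T i)%:R
                             <= (d%:R / (2 * r%:R) + e / r%:R) * n%:R :> R]] ->
  (spanning_tree_discrepancy R r G <= ((d%:R / 2 - 1 + 2 * e) * n%:R)%:E)%E.
Proof.
move=> r0 en /existsP[f /forallP h].
apply: le_trans (bigmin_le_cond _ _ (isT : xpredT f)) _.
apply/bigmax_leP; split; first by rewrite leNye.
move=> T sT; have := h T; rewrite sT /= => /forallP {}h; rewrite lee_fin /tree_discrepancy.
have r0' : 0 < r%:R :> R by rewrite ltr0n.
have {}le : (\max_(i < r) color_count f T i)%N%:R <= (d%:R / (2 * r%:R) + e / r%:R) * n%:R :> R.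
  case: r r0 f h r0' => // r _ f h _.
  by have [|i ->] := @bigop.eq_bigmax 'I_r.+1 (color_count f T); rewrite ?card_ord.
rewrite -(ler_pM2l r0') in le.
rewrite mulrBr mulrCA divff ?gt_eqF // mulr1.
have : (d%:R / 2 + e) * n%:R =
  r%:R * ((d%:R / (2 * r%:R) + e / r%:R) * n%:R) :> R.
  by field; rewrite gt_eqF.
lra.
Qed.

Lemma many_edges_of_one_color (R : realType) (d n r E : nat) (e : R)
    (p := (24 * E * d)%N) (c := (6 * r * E * d)%N)
    (K := ((256 * (d * d)) ^ p)%N) (w := (6 * r * E * p ^ 2)%N)
    (G : {set {set 'I_n}}) :
  (0 < d)%N -> (0 < E)%N -> 1 <= e * E%:R -> (8 * K * d <= r)%N -> (2 * r <= n)%N ->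
  G \in regular_graphs d n -> good_graph G p c K w ->
  [forall f : coloring G r, exists T : {set {set 'I_n}},
     spanning_tree G T &&
     [exists i : 'I_r, (d%:R / (2 * r%:R) - e / r%:R) * n%:R
                         <= (color_count f T i)%:R :> R]].
Proof.
move=> d0 E0 eE Kr rn Gr gG; apply/forallP => f.
have [T [i [sT le]]] := good_graph_coloring f d0 E0 Kr rn Gr gG.
apply/existsP; exists T; rewrite sT; apply/existsP; exists i.
have r0 : 0 < r%:R :> R by rewrite ltr0n (leq_ltn_trans _ (ltn_ord i)).
have E0' : 0 < E%:R :> R by rewrite ltr0n.
move: le; rewrite -(ler_nat R) !natrD !natrM => le.
set t := (color_count f T i)%:R in le *.
have -> : (d%:R / (2 * r%:R) - e / r%:R) * n%:R =
    (d%:R * n%:R / 2 - e * n%:R) / r%:R :> R by field; rewrite gt_eqF.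
rewrite ler_pdivrMr // -(ler_pM2l E0').
have : n%:R <= e * E%:R * n%:R :> R by rewrite ler_peMl.
have := ler0n R n; lra.
Qed.

Lemma balanced_coloring_few_edges (R : realType) (d n r : nat) (e : R)
    (G : {set {set 'I_n}}) :
  (0 < r)%N -> r%:R <= e * n%:R -> G \in regular_graphs d n ->
  [exists f : coloring G r, forall T : {set {set 'I_n}},
     spanning_tree G T ==>
     [forall i : 'I_r, (color_count f T i)%:R
                         <= (d%:R / (2 * r%:R) + e / r%:R) * n%:R :> R]].
Proof.
move=> r0 re Gr; have [f fP] := balanced_coloring G r0.
apply/existsP; exists f; apply/forallP => T; apply/implyP => _; apply/forallP => i.
have := card_regular_graph Gr; have := fP T i.
rewrite -(ler_nat R) natrD natrM => le /(congr1 (fun k => k%:R : R)); rewrite !natrM => dn.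
have r0' : 0 < r%:R :> R by rewrite ltr0n.
have -> : (d%:R / (2 * r%:R) + e / r%:R) * n%:R =
    (d%:R * n%:R / 2 + e * n%:R) / r%:R :> R by field; rewrite gt_eqF.
rewrite ler_pdivlMr //; lra.
Qed.

Theorem theorem1p6 (R : realType) (d : nat) (hd : (3 <= d)%N)
    (eps : R) (heps : 0 < eps) :
  exists r0 : nat, forall r : nat, (r0 <= r)%N ->
    whp R d (fun n G =>
      (((d%:R / 2 - 1 - eps) * n%:R)%:E <= spanning_tree_discrepancy R r G)%E &&
      (spanning_tree_discrepancy R r G <= ((d%:R / 2 - 1 + eps) * n%:R)%:E)%E)
    /\
    whp R d (fun n G =>
      [forall f : coloring G r, exists T : {set {set 'I_n}},
         spanning_tree G T &&
         [exists i : 'I_r, (d%:R / (2 * r%:R) - eps / r%:R) * n%:R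
                             <= (color_count f T i)%:R :> R]])
    /\
    whp R d (fun n G =>
      [exists f : coloring G r, forall T : {set {set 'I_n}},
         spanning_tree G T ==>
         [forall i : 'I_r, (color_count f T i)%:R
                             <= (d%:R / (2 * r%:R) + eps / r%:R) * n%:R :> R]]).
Proof.
have d0 : (0 < d)%N by apply: leq_trans hd.
(* [E] replaces 1 / eps by an integer, so that the combinatorial bounds stay in the natural
   numbers. *)
have [E E0 eE] : exists2 E : nat, (0 < E)%N & 1 <= eps * E%:R.
  exists (Num.bound eps^-1).+1 => //; rewrite -ler_pdivrMl // mulr1.
  by apply/ltW/(lt_trans (archi_boundP _)); rewrite ?ltr_nat // invr_ge0 ltW.
pose p := (24 * E * d)%N; pose K := ((256 * (d * d)) ^ p)%N.
exists (8 * K * d)%N => r Kr.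
pose c := (6 * r * E * d)%N; pose w := (6 * r * E * p ^ 2)%N.
have K0 : (0 < K)%N by rewrite expn_gt0 !muln_gt0 d0.
have r0 : (0 < r)%N by apply: leq_trans Kr; rewrite !muln_gt0 K0.
have p1 : (1 < p)%N by rewrite /p; nia.
have c0 : (0 < c)%N by rewrite !muln_gt0 r0 E0.
have e20 : 0 < eps / 2 by rewrite divr_gt0.
(* From [M] on, the rounding error [r] of the balanced colouring is at most half of eps n; the other
   half is kept for [discrepancy_upper]. *)
pose M := Num.bound (r%:R / (eps / 2)).
have MP n : (M <= n)%N -> r%:R <= eps / 2 * n%:R.
  move=> Mn; rewrite -ler_pdivrMl // mulrC; apply: ltW.
  apply: (lt_le_trans (archi_boundP _)); last by rewrite ler_nat.
  by rewrite divr_ge0 // ltW.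
pose n0 := (40 * (d * d) + 2 * c + 4 * p + 2 * r + M)%N.
(* All three claims hold for every good graph with enough vertices, so probability enters only
   here. *)
have whp_of_good (A : forall n, pred {set {set 'I_n}}) :
    (forall n (G : {set {set 'I_n}}), (n0 <= n)%N -> G \in regular_graphs d n ->
       good_graph G p c K w -> A n G) -> whp R d A.
  move=> goodA; apply: (@whp_of_rare_failure R d A n0 _) => n n0n _.
  have [h1 h2 h3] : [/\ 40 * (d * d) <= n, 2 * c <= n & 4 * p <= n]%N.
    by move: n0n; rewrite /n0; split; lia.
  apply: leq_trans (@card_not_good_graph d n p c w hd p1 c0 h1 h2 h3).
  rewrite leq_mul2r; apply/orP; right; apply: subset_leq_card.
  apply/fintype.subsetP => G; rewrite !inE => /andP[/[dup] GR -> /=].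
  by apply: contra; apply: goodA => //; rewrite inE.
have few n (G : {set {set 'I_n}}) : (n0 <= n)%N -> r%:R <= eps / 2 * n%:R :> R.
  by move=> n0n; apply: MP; move: n0n; rewrite /n0; lia.
have rn n : (n0 <= n)%N -> (2 * r <= n)%N by rewrite /n0; lia.
split; [|split]; apply: whp_of_good => n G n0n Gr gG.
- apply/andP; split.
    exact: discrepancy_lower (many_edges_of_one_color d0 E0 eE Kr (rn n n0n) Gr gG).
  have re := few n G n0n.
  have -> : eps = 2 * (eps / 2) by field.
  apply: discrepancy_upper => //; last exact: balanced_coloring_few_edges re Gr.
  by apply: le_trans re; rewrite ler1n.
- exact: many_edges_of_one_color d0 E0 eE Kr (rn n n0n) Gr gG.
- apply: balanced_coloring_few_edges => //; apply: le_trans (few n G n0n) _.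
  by rewrite ler_wpM2r // ler_pdivrMr // ler_peMr ?ler1n // ltW.
Qed.
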